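(* Let $(b,c)$ be a graph over $(X,m)$ with $m=n$ and $c\equiv0$, where $n(x)=\sum_{y\in X}b(x,y)$, and let $p\in[1,\infty]$. Then $\sigma(L_p)\subseteq\{z\in\mathbb{C}: |z-1|\le1\}$, and $\sigma(L_p)$ is symmetric with respect to $\mathbb{R}$, i.e., $\lambda\in\sigma(L_p)$ if and only if $\overline{\lambda}\in\sigma(L_p)$. Moreover, if the graph is bipartite, then $\sigma(L_p)$ is symmetric with respect to the line $\{z\in\mathbb{C}:\operatorname{Re}z=1\}$, i.e., $\lambda\in\sigma(L_p)$ if and only if $2-\lambda\in\sigma(L_p)$.
   Context: Graphs. $X$ is a countable set with the discrete topology, $m:X\to(0,\infty)$, $m(A)=\sum_{x\in A}m(x)$. A graph over $(X,m)$ is a pair $(b,c)$ with $c:X\to[0,\infty)$ and $b:X\times X\to[0,\infty)$ symmetric, with zero diagonal, and $\sum_{y\in X}b(x,y)<\infty$ for all $x\in X$. It is assumed that for every $x\in X$ there is $y\in X$ with $b(x,y)>0$. The graph is bipartite if $X$ is a disjoint union $X_1\cup X_2$ such that $b(x,y)>0$ implies $(x,y)\in(X_1\times X_2)\cup(X_2\times X_1)$. Operators. $\ell^p=\ell^p(X,m)$, $p\in[1,\infty]$, are the complex $\ell^p$-spaces with norms $\|f\|_p=(\sum_x|f(x)|^pm(x))^{1/p}$ for $p<\infty$ and $\|f\|_\infty=\sup_x|f(x)|$. $C_c(X)$ is the space of finitely supported complex functions. Let $$Q(f,g)=\frac12\sum_{x,y\in X}b(x,y)(f(x)-f(y))\overline{(g(x)-g(y))}+\sum_{x\in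 X}c(x)f(x)\overline{g(x)},$$ with domain $D(Q)$ the closure of $C_c(X)$ with respect to $\|f\|_Q=(Q(f,f)+\|f\|_2^2)^{1/2}$, and let $L=L_2$ be the associated positive selfadjoint operator on $\ell^2(X,m)$. The semigroup $T_t=e^{-tL}$, $t\ge0$, extends consistently to contraction semigroups on all $\ell^p$, $p\in[1,\infty]$, strongly continuous for $p<\infty$. For $p\in[1,\infty)$, $L_p$ denotes the generator on $\ell^p$ with the sign convention $T_t=e^{-tL_p}$, and $L_\infty:=L_1^*$ is the dual operator on $\ell^\infty$. For $m=n$, $c\equiv0$ the $L_p$ are bounded operators acting as $L_pf(x)=\frac1{n(x)}\sum_{y\in X}b(x,y)(f(x)-f(y))$ (the normalized Laplacian). $\sigma(L_p)$ denotes the spectrum of $L_p$ on $\ell^p$. *)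

(* Defs.v *)
From HB Require Import structures.
From mathcomp Require Import all_boot all_order all_algebra.
From mathcomp Require Import all_classical all_reals all_analysis.
From mathcomp Require Import complex.
Set Implicit Arguments.
Unset Strict Implicit.
Unset Printing Implicit Defensive.
Import Order.TTheory GRing.Theory Num.Theory.
Import numFieldNormedType.Exports.
Import ComplexField.Normc.

Local Open Scope classical_set_scope.
Local Open Scope ring_scope.
Local Open Scope complex_scope.

Section Sums.
Variables (R : realType) (T : choiceType).

(* Unordered sums over all of T; the values are meaningful for absolutely
   summable families (all four extended sums finite). *)
Definition rsum (u : T -> R) : R :=
  fine (\esum_(x in [set: T]) (Num.max (u x) 0)%:E) -
  fine (\esum_(x in [set: T]) (Num.max (- u x) 0)%:E).

Definition csum (u : T -> R[i]) : R[i] :=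
  rsum (fun x => complex.Re (u x)) +i* rsum (fun x => complex.Im (u x)).

End Sums.

Section Lp.
Variables (R : realType) (X : countType) (m : X -> R).
Implicit Types (p : \bar R) (f g : X -> R[i]).

(* The maximum with 0 only matters when X is empty. *)
Definition lnorm p f : \bar R :=
  match p with
  | r%:E => ((\esum_(x in [set: X]) (normc (f x) `^ r * m x)%:E) `^ r^-1)%E
  | +oo%E => maxe 0%E (ereal_sup (range (fun x => (normc (f x))%:E)))
  | -oo%E => 0%E
  end.

Definition lp p : set (X -> R[i]) := [set f | (lnorm p f < +oo)%E].

(* A possibly unbounded operator on a space of functions is represented by its
   graph: A f g means that f lies in the domain and A f = g. *)
Definition operator := (X -> R[i]) -> (X -> R[i]) -> Prop.

Definition inner2 f g : R[i] := csum (fun x => f x * (g x)^* * (m x)%:C).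

Definition dual_pairing f g : R[i] := csum (fun x => f x * g x * (m x)%:C).

(* The Banach space adjoint on l^oo = (l^1)' of an operator on l^1. *)
Definition adjoint1 (A : operator) : operator := fun f g =>
  [/\ lp +oo%E f, lp +oo%E g &
      forall h k, A h k -> dual_pairing k f = dual_pairing h g].

Definition in_resolvent_set p (A : operator) (z : R[i]) : Prop :=
  exists2 B : (X -> R[i]) -> (X -> R[i]),
    exists M : R, forall f, lp p f -> (lnorm p (B f) <= M%:E * lnorm p f)%E &
    (forall g, lp p g -> exists2 h, A (B g) h & z \*o B g - h = g) /\
    (forall f h, A f h -> B (z \*o f - h) = f).

Definition spectrum p (A : operator) : set (R[i]) :=
  [set z | ~ in_resolvent_set p A z].

(* Families of operators T t, t >= 0, given as maps on all functions so that
   the same T acts consistently on every l^p. *)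
Implicit Type T : R -> (X -> R[i]) -> (X -> R[i]).

Definition contraction_semigroup p T : Prop :=
  [/\ forall t f, 0 <= t -> lp p f -> (lnorm p (T t f) <= lnorm p f)%E,
      forall t (a : R[i]) f g, 0 <= t -> lp p f -> lp p g ->
        T t (a \*o f + g) = a \*o T t f + T t g,
      forall f, lp p f -> T 0 f = f &
      forall s t f, 0 <= s -> 0 <= t -> lp p f -> T (s + t) f = T s (T t f)].

Definition strongly_continuous p T : Prop :=
  forall f, lp p f -> lnorm p (T t f - f) @[t --> 0^'+] --> 0%E.

(* Sign convention: if A is the generator, then T t = exp (- t A). *)
Definition generator p T : operator := fun f g =>
  [/\ lp p f, lp p g &
      lnorm p ((t^-1)%:C \*o (f - T t f) - g) @[t --> 0^'+] --> 0%E].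

End Lp.

Record graph (R : realType) (X : countType) := Graph {
  gb : X -> X -> R;
  gc : X -> R;
  gc_ge0 : forall x, 0 <= gc x;
  gb_ge0 : forall x y, 0 <= gb x y;
  gb_sym : forall x y, gb x y = gb y x;
  gb_diag : forall x, gb x x = 0;
  gb_summable : forall x, (\esum_(y in [set: X]) (gb x y)%:E < +oo)%E;
  gb_neighbor : forall x, exists y, 0 < gb x y
}.

Section Graphs.
Variables (R : realType) (X : countType) (G : graph R X).
Implicit Types (f g : X -> R[i]).

Definition degree (x : X) : R := fine (\esum_(y in [set: X]) (gb G x y)%:E).

Definition bipartite : Prop :=
  exists X1 X2 : set X,
    [/\ X1 `|` X2 = [set: X], X1 `&` X2 = set0 &
        forall x y, 0 < gb G x y -> (X1 x /\ X2 y) \/ (X2 x /\ X1 y)].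

Definition Cc : set (X -> R[i]) := [set f | finite_set [set x | f x != 0]].

Definition Q f g : R[i] :=
  (2^-1)%:C * csum (fun xy : X * X =>
     (gb G xy.1 xy.2)%:C * (f xy.1 - f xy.2) * (g xy.1 - g xy.2)^*)
  + csum (fun x => (gc G x)%:C * f x * (g x)^*).

(* Q f f as an extended real, +oo when the defining series diverge. *)
Definition energy f : \bar R :=
  ((2^-1)%:E * (\esum_(xy in [set: X * X])
     (gb G xy.1 xy.2 * normc (f xy.1 - f xy.2) ^+ 2)%:E)
   + (\esum_(x in [set: X]) (gc G x * normc (f x) ^+ 2)%:E))%E.

Variable m : X -> R.

Definition Qnorm f : \bar R := ((energy f + lnorm m 2%:E f ^+ 2) `^ 2^-1)%E.

Definition DQ : set (X -> R[i]) :=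
  [set f | forall e : R, 0 < e -> exists2 phi, Cc phi & (Qnorm (f - phi)%R < e%:E)%E].

(* The selfadjoint operator on l^2 associated with the closed form Q on DQ. *)
Definition L2 : operator R X := fun f g =>
  [/\ DQ f, lp m 2%:E g & forall h, DQ h -> Q f h = inner2 m g h].

(* T = exp (- t L2) on l^2, characterized as the strongly continuous contraction
   semigroup with generator L2, together with its consistent extensions. *)
Definition heat_semigroup (T : R -> (X -> R[i]) -> (X -> R[i])) : Prop :=
  (forall f g, generator m 2%:E T f g <-> L2 f g) /\
  (forall p : \bar R, (1 <= p)%E ->
     contraction_semigroup m p T /\
     ((p < +oo)%E -> strongly_continuous m p T)).

(* A heat semigroup is determined by G and m on every l^p, p finite, so the
   choice of T below is immaterial. *)
Definition Lp_fin (p : \bar R) : operator R X := fun f g =>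
  exists2 T, heat_semigroup T & generator m p T f g.

Definition Lp (p : \bar R) : operator R X :=
  if p is +oo%E then adjoint1 m (Lp_fin 1%E) else Lp_fin p.

End Graphs.

(* Main.v *)
Require Import Defs.
From HB Require Import structures.
From mathcomp Require Import all_boot all_order all_algebra.
From mathcomp Require Import all_classical all_reals all_analysis.
From mathcomp Require Import complex.
From mathcomp Require Import ring lra.
Set Implicit Arguments.
Unset Strict Implicit.
Unset Printing Implicit Defensive.
Import Order.TTheory GRing.Theory Num.Theory.
Import numFieldNormedType.Exports.
Import ComplexField.Normc.
Local Open Scope classical_set_scope.
Local Open Scope ring_scope.
Local Open Scope complex_scope.

(** The whole theorem reduces to one identification: for every exponent p >= 1
    the operator L_p is everywhere defined on l^p and equals 1 - P, where
    P f(x) = (1/m(x)) sum_y b(x,y) f(y) is the transition operator of the random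
    walk.  Since b is symmetric and m is the degree, P is a Markov operator with
    invariant measure m, so Jensen's inequality makes it a contraction of every
    l^p (mean_bound).

    Spectral part.  With w = z - 1 one has z - L = w + P, so for |w| > 1 the
    Neumann series inverts z - L (resolvent_outside_disk).  Because b is real, P
    commutes with complex conjugation, and conjugating a resolvent at z gives one
    at the conjugate of z (resolvent_conj).  If the graph is bipartite,
    multiplication by the function s equal to 1 on one part and -1 on the other
    anticommutes with P, hence conjugates L into 2 - L (resolvent_reflect).

    Identification of L_p.  The operators needed are of the form sum_n a_n P^n
    with an absolutely summable sequence a; they are bounded by sum_n |a_n| on
    every l^p at once (power_series_bound) and multiply by the Cauchy product of
    the coefficients (power_series_comp).  The Poisson weights e^{-t} t^n / n!
    give a semigroup, and the coefficients of (1 - e^{-tL}) / t - L have total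
    mass 2 (1 - e^{-t}), so its generator on l^p is L (heat_generator).  On l^2 a
    discrete Green formula (green_formula), together with the density of finitely
    supported functions, shows that L is the operator of the form Q
    (L2_laplacian); so this semigroup is a heat semigroup.

    The definition of L_p quantifies over all heat semigroups, so uniqueness is
    also needed.  Any heat semigroup T commutes with the bounded operator L on
    l^2; this makes the error of the difference quotient uniform along the orbit
    of T, and a telescoping sum gives T_t = e^{-tL} on l^2 (heat_unique_l2).
    Density extends this to l^p for finite p (heat_unique).  For p = oo the
    symmetry of L in the pairing of l^1 and l^oo identifies the adjoint
    (adjoint_laplacian). *)

(** * Unordered sums of nonnegative, real and complex families *)

Section NonnegativeSums.
Variable R : realType.
Implicit Types T : choiceType.

Definition nsum T (u : T -> R) : \bar R := \esum_(x in [set: T]) (u x)%:E.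

Lemma nsum_ge0 T (u : T -> R) : (forall x, 0 <= u x) -> (0 <= nsum u)%E.
Proof. by move=> u0; apply: esum_ge0 => x _; rewrite lee_fin. Qed.

Lemma le_nsum T (u v : T -> R) : (forall x, u x <= v x) -> (nsum u <= nsum v)%E.
Proof. by move=> uv; apply: le_esum => x _; rewrite lee_fin. Qed.

Lemma eq_nsum T (u v : T -> R) : u =1 v -> nsum u = nsum v.
Proof. by move=> /funext ->. Qed.

Lemma nsumD T (u v : T -> R) : (forall x, 0 <= u x) -> (forall x, 0 <= v x) ->
  nsum (fun x => u x + v x) = (nsum u + nsum v)%E.
Proof.
by move=> u0 v0; rewrite -esumD// => x _; rewrite lee_fin.
Qed.

Lemma nsum0 T (u : T -> R) : (forall x, u x = 0) -> nsum u = 0%E.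
Proof. by move=> u0; apply: esum1 => x _; rewrite u0. Qed.

Lemma esumZl T c (a : T -> \bar R) : 0 <= c -> (forall x, (0 <= a x)%E) ->
  (\esum_(x in [set: T]) (c%:E * a x) = c%:E * \esum_(x in [set: T]) a x)%E.
Proof.
move=> c0 a0; rewrite /esum -ereal_supZl//; last first.
  by apply/set0P; exists (\sum_(x \in set0) a x)%E; exists set0 => //; exact: fsets_set0.
congr ereal_sup; rewrite image_comp; apply: eq_imagel => A _ /=.
by rewrite ge0_mule_fsumr.
Qed.

Lemma nsumZl T c (u : T -> R) : 0 <= c -> (forall x, 0 <= u x) ->
  nsum (fun x => c * u x) = (c%:E * nsum u)%E.
Proof.
by move=> c0 u0; rewrite -esumZl//; apply: eq_esum => x _; rewrite EFinM.
Qed.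

Lemma nsum_fin T (u : T -> R) : (forall x, 0 <= u x) -> (nsum u < +oo)%E ->
  nsum u = (fine (nsum u))%:E.
Proof.
by move=> u0 uoo; rewrite fineK// ge0_fin_numE// nsum_ge0.
Qed.

Lemma nsum_term T (u : T -> R) x : (forall x, 0 <= u x) -> ((u x)%:E <= nsum u)%E.
Proof.
move=> u0; rewrite /nsum (esumID [set x])//; last by move=> y _; rewrite lee_fin.
rewrite setTI esum_set1 ?lee_fin// leeDl//.
by apply: esum_ge0 => y _; rewrite lee_fin.
Qed.

Lemma nsum_pair (T1 T2 : choiceType) (u : T1 -> T2 -> R) :
  (forall x y, 0 <= u x y) ->
  nsum (fun xy : T1 * T2 => u xy.1 xy.2) = (\esum_(x in [set: T1]) nsum (u x))%E.
Proof.
move=> u0; rewrite /nsum esum_esum//; last by move=> x y _ _; rewrite lee_fin.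
by congr esum; apply/seteqP; split.
Qed.

Lemma nsum_fubini (T1 T2 : choiceType) (u : T1 -> T2 -> R) :
  (forall x y, 0 <= u x y) ->
  (\esum_(x in [set: T1]) nsum (u x) =
   \esum_(y in [set: T2]) nsum (fun x => u x y))%E.
Proof.
move=> u0; rewrite -!nsum_pair// /nsum.
rewrite (@reindex_esum R (T2 * T1)%type (T1 * T2)%type setT setT (fun p => (p.2, p.1)))//.
split => //; first by move=> [x y] [x' y'] _ _ /= [-> ->].
by move=> [x y] _; exists (y, x).
Qed.

Lemma nsum_iter_fin (T1 T2 : choiceType) (u : T1 -> T2 -> R) :
  (forall x y, 0 <= u x y) -> (\esum_(x in [set: T1]) nsum (u x) < +oo)%E ->
  (forall x, (nsum (u x) < +oo)%E) /\
  nsum (fun x => fine (nsum (u x))) = (\esum_(x in [set: T1]) nsum (u x))%E.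
Proof.
move=> u0 uoo.
have ufin x : (nsum (u x) < +oo)%E.
  have u0' y : (0 <= nsum (u y))%E by exact: nsum_ge0.
  have := @summable_pinfty T1 R setT (fun x => nsum (u x)).
  rewrite /summable; under eq_esum do rewrite gee0_abs//.
  by move=> /(_ uoo x Logic.I); rewrite gee0_abs.
split => //; apply: eq_esum => x _; rewrite -nsum_fin//.
Qed.

Lemma nsum_inj (T1 T2 : choiceType) (e : T1 -> T2) (u : T2 -> R) :
  injective e -> (forall y, (forall x, e x != y) -> u y = 0) ->
  nsum u = nsum (u \o e).
Proof.
move=> einj u0; rewrite /nsum.
transitivity (\esum_(j in range e) (u j)%:E)%E.
  rewrite [RHS]esum_mkcond; apply: eq_esum => y _; case: ifPn => // ye.
  rewrite u0// => x; apply: contra ye => /eqP <-.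
  by rewrite inE; exists x.
by rewrite esum_image// => x y _ _; exact: einj.
Qed.

Lemma nsum_unit (u : unit -> R) : 0 <= u tt -> nsum u = (u tt)%:E.
Proof.
move=> u0; rewrite /nsum (_ : [set: unit] = [set tt]) ?esum_set1//.
by apply/seteqP; split => -[].
Qed.

Lemma nsum_delta T (u : T -> R) a : 0 <= u a -> (forall x, x != a -> u x = 0) ->
  nsum u = (u a)%:E.
Proof.
move=> ua u0; rewrite (@nsum_inj unit T (fun=> a)).
- by rewrite nsum_unit.
- by move=> [] [].
- by move=> y /(_ tt); rewrite eq_sym => /u0.
Qed.

End NonnegativeSums.

Section SignedSums.
Variable R : realType.
Implicit Types T : choiceType.

(** Any splitting of u into a difference of nonnegative summable families computes
    its sum, because u^+ + b = u^- + a.  Linearity and the Fubini theorem for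
    signed sums follow from the nonnegative case through this. *)
Lemma rsumE T (u a b : T -> R) : (forall x, 0 <= a x) -> (forall x, 0 <= b x) ->
  (nsum a < +oo)%E -> (nsum b < +oo)%E -> (forall x, u x = a x - b x) ->
  rsum u = fine (nsum a) - fine (nsum b).
Proof.
move=> a0 b0 aoo boo uE.
set up := fun x => Num.max (u x) 0; set um := fun x => Num.max (- u x) 0.
have up0 x : 0 <= up x by rewrite le_max lexx orbT.
have um0 x : 0 <= um x by rewrite le_max lexx orbT.
have upa x : up x <= a x by rewrite ge_max a0 andbT uE; have := b0 x; lra.
have umb x : um x <= b x by rewrite ge_max b0 andbT uE; have := a0 x; lra.
have upoo : (nsum up < +oo)%E by apply: le_lt_trans aoo; exact: le_nsum.
have umoo : (nsum um < +oo)%E by apply: le_lt_trans boo; exact: le_nsum.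
have : nsum (fun x => up x + b x) = nsum (fun x => um x + a x).
  apply: eq_nsum => x; rewrite /up /um.
  case: (lerP 0 (u x)) => h.
    rewrite (max_r (x := - u x)) ?oppr_le0// uE; lra.
  rewrite (max_l (x := - u x)) ?oppr_ge0 ?ltW// uE; lra.
rewrite !nsumD// (nsum_fin a0 aoo) (nsum_fin b0 boo) (nsum_fin up0 upoo) (nsum_fin um0 umoo).
move=> -[]; rewrite /rsum -/(nsum up) -/(nsum um) /=; lra.
Qed.

Definition rsummable T (u : T -> R) := (nsum (fun x => `|u x|%R) < +oo)%E.

Lemma rsummable_parts T (u : T -> R) : rsummable u ->
  exists a b : T -> R, [/\ (forall x, 0 <= a x), (forall x, 0 <= b x),
  (nsum a < +oo)%E, (nsum b < +oo)%E & (forall x, u x = a x - b x) /\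
   (forall x, `|u x| = a x + b x)].
Proof.
move=> uoo; exists (fun x => Num.max (u x) 0), (fun x => Num.max (- u x) 0).
have h x : `|u x| = Num.max (u x) 0 + Num.max (- u x) 0.
  case: (lerP 0 (u x)) => h.
    by rewrite (max_r (x := - u x)) ?oppr_le0// addr0 ger0_norm.
  by rewrite (max_l (x := - u x)) ?oppr_ge0 ?ltW// add0r ltr0_norm.
split => [x|x|||].
- by rewrite le_max lexx orbT.
- by rewrite le_max lexx orbT.
- by apply: le_lt_trans uoo; apply: le_nsum => x; rewrite h lerDl le_max lexx orbT.
- by apply: le_lt_trans uoo; apply: le_nsum => x; rewrite h lerDr le_max lexx orbT.
split=> // x.
case: (lerP 0 (u x)) => hx.
  by rewrite (max_r (x := - u x)) ?oppr_le0// subr0.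
by rewrite (max_l (x := - u x)) ?oppr_ge0 ?ltW// sub0r opprK.
Qed.

Lemma eq_rsum T (u v : T -> R) : u =1 v -> rsum u = rsum v.
Proof. by move=> /funext ->. Qed.

Lemma rsum0 T (u : T -> R) : (forall x, u x = 0) -> rsum u = 0.
Proof.
move=> u0; rewrite (@rsumE _ _ u u) ?subrr//; try by move=> x; rewrite ?u0 ?subrr.
all: by rewrite nsum0.
Qed.

Lemma rsum_ge0 T (u : T -> R) : (forall x, 0 <= u x) -> rsum u = fine (nsum u).
Proof.
move=> u0; rewrite /rsum.
rewrite (_ : (\esum_(x in [set: T]) (Num.max (u x) 0)%:E)%E = nsum u); last first.
  by apply: eq_nsum => x; rewrite (max_idPl _).
rewrite (_ : (\esum_(x in [set: T]) (Num.max (- u x) 0)%:E)%E = 0%E) ?subr0//.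
by apply: esum1 => x _; rewrite (max_idPr _) ?oppr_le0.
Qed.

Lemma rsumD T (u v : T -> R) : rsummable u -> rsummable v ->
  rsum (fun x => u x + v x) = rsum u + rsum v.
Proof.
move=> /rsummable_parts[a [b [a0 b0 aoo boo [uE _]]]].
move=> /rsummable_parts[c [d [c0 d0 coo doo [vE _]]]].
rewrite (rsumE a0 b0 aoo boo uE) (rsumE c0 d0 coo doo vE).
rewrite (@rsumE _ _ (fun x => a x + c x) (fun x => b x + d x)).
- by rewrite !nsumD// !fineD ?ge0_fin_numE ?nsum_ge0//; lra.
- by move=> x; exact: addr_ge0.
- by move=> x; exact: addr_ge0.
- by rewrite nsumD// lte_add_pinfty.
- by rewrite nsumD// lte_add_pinfty.
- by move=> x; rewrite uE vE; lra.
Qed.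

Lemma rsumN T (u : T -> R) : rsum (fun x => - u x) = - rsum u.
Proof.
rewrite /rsum opprB; congr (fine _ - fine _); apply: eq_esum => x _.
by rewrite opprK.
Qed.

Lemma rsumZ T c (u : T -> R) : rsummable u ->
  rsum (fun x => c * u x) = c * rsum u.
Proof.
move=> us.
wlog c0 : c / 0 <= c => [hw|].
  case: (lerP 0 c) => c0; first exact: hw.
  rewrite -[LHS]opprK -rsumN -[c in RHS]opprK [RHS]mulNr -hw ?oppr_ge0 ?ltW//.
  by congr (- _); apply: eq_rsum => x; rewrite mulNr.
move: us => /rsummable_parts[a [b [a0 b0 aoo boo [uE _]]]].
rewrite (rsumE a0 b0 aoo boo uE).
have h w : (forall x : T, 0 <= w x) -> (nsum w < +oo)%E ->
  nsum (fun x => c * w x) = (c * fine (nsum w))%:E.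
  by move=> w0 woo; rewrite nsumZl// (nsum_fin w0 woo).
rewrite (@rsumE _ _ (fun x => c * a x) (fun x => c * b x)) ?h ?ltry//=; first lra.
- by move=> x; exact: mulr_ge0.
- by move=> x; exact: mulr_ge0.
- by move=> x; rewrite uE; lra.
Qed.

Lemma rsum_le T (u : T -> R) : ((rsum u)%:E <= nsum (fun x => `|u x|%R))%E.
Proof.
have := leey (nsum (fun x => `|u x|)); rewrite le_eqVlt => /predU1P[->|us].
  by rewrite leey.
have [a [b [a0 b0 aoo boo [uE uA]]]] := rsummable_parts us.
rewrite (rsumE a0 b0 aoo boo uE) (eq_nsum uA) nsumD//.
rewrite {2}(nsum_fin a0 aoo) {2}(nsum_fin b0 boo) -EFinD lee_fin.
have : 0 <= fine (nsum b) by rewrite fine_ge0// nsum_ge0.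
lra.
Qed.

Lemma rsum_inj (T1 T2 : choiceType) (e : T1 -> T2) (u : T2 -> R) :
  injective e -> (forall y, (forall x, e x != y) -> u y = 0) ->
  rsum u = rsum (u \o e).
Proof.
move=> einj u0; rewrite /rsum; congr (fine _ - fine _).
  rewrite -/(nsum (fun y => Num.max (u y) 0)) (nsum_inj einj)// => y /u0 ->.
  by rewrite maxxx.
rewrite -/(nsum (fun y => Num.max (- u y) 0)) (nsum_inj einj)// => y /u0 ->.
by rewrite oppr0 maxxx.
Qed.

Lemma rsum_pair (T1 T2 : choiceType) (u : T1 -> T2 -> R) :
  (\esum_(x in [set: T1]) nsum (fun y => `|u x y|%R) < +oo)%E ->
  rsum (fun xy : T1 * T2 => u xy.1 xy.2) = rsum (fun x => rsum (u x)).
Proof.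
move=> us.
have us2 : rsummable (fun xy : T1 * T2 => u xy.1 xy.2).
  by rewrite /rsummable (nsum_pair (u := fun x y => `|u x y|)).
have [a' [b' [a0' b0' aoo' boo' [uE' _]]]] := rsummable_parts us2.
rewrite (rsumE a0' b0' aoo' boo' uE').
pose a x y := a' (x, y); pose b x y := b' (x, y).
have ea : a' = (fun xy => a xy.1 xy.2) by apply/funext => -[].
have eb : b' = (fun xy => b xy.1 xy.2) by apply/funext => -[].
have a0 x y : 0 <= a x y by exact: a0'.
have b0 x y : 0 <= b x y by exact: b0'.
have uE x y : u x y = a x y - b x y by exact: (uE' (x, y)).
move: aoo' boo'; rewrite ea eb !nsum_pair// => aoo boo.
have [ai as_] := nsum_iter_fin a0 aoo.
have [bi bs] := nsum_iter_fin b0 boo.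
rewrite -as_ -bs; apply/esym/rsumE.
- by move=> x; rewrite fine_ge0// nsum_ge0.
- by move=> x; rewrite fine_ge0// nsum_ge0.
- by rewrite as_.
- by rewrite bs.
- by move=> x; apply: rsumE.
Qed.

End SignedSums.

Section ComplexModulus.
Variable R : realType.
Implicit Types z : R[i].

Lemma normc_ge0 z : 0 <= normc z.
Proof. by case: z => a b /=; exact: sqrtr_ge0. Qed.

Lemma normr_normc z : `|z| = (normc z)%:C.
Proof. by []. Qed.

Lemma normc_real (a : R) : normc a%:C = `|a|.
Proof. by rewrite /= expr0n /= addr0 sqrtr_sqr. Qed.

Lemma normc_conj z : normc z^* = normc z.
Proof. by case: z => a b /=; rewrite sqrrN. Qed.

Lemma le_Re_normc z : `|complex.Re z| <= normc z.
Proof.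
by case: z => a b /=; rewrite -sqrtr_sqr ler_wsqrtr// lerDl sqr_ge0.
Qed.

Lemma le_Im_normc z : `|complex.Im z| <= normc z.
Proof.
by case: z => a b /=; rewrite -sqrtr_sqr ler_wsqrtr// lerDr sqr_ge0.
Qed.

Lemma mul_conjc z : z^* * z = (normc z ^+ 2)%:C.
Proof.
case: z => a b; rewrite /normc sqr_sqrtr ?addr_ge0 ?sqr_ge0//.
by apply/eqP; rewrite eq_complex/=; apply/andP; split; apply/eqP; ring.
Qed.

Lemma normcB_le z1 z2 : normc (z1 - z2) <= normc z1 + normc z2.
Proof. by rewrite -(normcN z2); exact: le_normcD. Qed.

End ComplexModulus.

Section ComplexSums.
Variable R : realType.
Implicit Types T : choiceType.

Definition csummable T (u : T -> R[i]) := (nsum (fun x => normc (u x)) < +oo)%E.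

Lemma csummable_le T (u : T -> R[i]) (v : T -> R) :
  (forall x, normc (u x) <= v x) -> (nsum v < +oo)%E -> csummable u.
Proof. by move=> uv; apply: le_lt_trans; exact: le_nsum. Qed.

Lemma csummable_ReIm T (u : T -> R[i]) : csummable u ->
  rsummable (fun x => complex.Re (u x)) /\ rsummable (fun x => complex.Im (u x)).
Proof.
move=> us; split; apply: le_lt_trans us; apply: le_nsum => x.
  exact: le_Re_normc.
exact: le_Im_normc.
Qed.

Lemma csummableD T (u v : T -> R[i]) : csummable u -> csummable v ->
  csummable (fun x => u x + v x).
Proof.
move=> us vs; apply: (@csummable_le _ _ (fun x => normc (u x) + normc (v x))).
  by move=> x; exact: le_normcD.
by rewrite nsumD ?lte_add_pinfty// => x; exact: normc_ge0.
Qed.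

Lemma csummableZ T c (u : T -> R[i]) : csummable u -> csummable (fun x => c * u x).
Proof.
move=> us; apply: (@csummable_le _ _ (fun x => normc c * normc (u x))).
  by move=> x; rewrite normcM.
rewrite nsumZl ?normc_ge0//; last by move=> x; exact: normc_ge0.
by rewrite lte_mul_pinfty ?lee_fin ?normc_ge0.
Qed.

Lemma csummableN T (u : T -> R[i]) : csummable u -> csummable (fun x => - u x).
Proof.
by move=> us; apply: le_lt_trans us; apply: le_nsum => x; rewrite normcN.
Qed.

Lemma eq_csum T (u v : T -> R[i]) : u =1 v -> csum u = csum v.
Proof. by move=> /funext ->. Qed.

Lemma csum0 T (u : T -> R[i]) : (forall x, u x = 0) -> csum u = 0.
Proof. by move=> u0; rewrite /csum !rsum0// => x; rewrite u0. Qed.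

Lemma csumD T (u v : T -> R[i]) : csummable u -> csummable v ->
  csum (fun x => u x + v x) = csum u + csum v.
Proof.
move=> /csummable_ReIm[ur ui] /csummable_ReIm[vr vi].
rewrite /csum; apply/eqP; rewrite eq_complex/= -rsumD// -rsumD//.
apply/andP; split; apply/eqP/eq_rsum => x.
  by case: (u x) => ? ?; case: (v x).
by case: (u x) => ? ?; case: (v x).
Qed.

Lemma csumN T (u : T -> R[i]) : csum (fun x => - u x) = - csum u.
Proof.
apply/eqP; rewrite eq_complex/= -!rsumN.
by apply/andP; split; apply/eqP/eq_rsum => x; case: (u x).
Qed.

Lemma csumB T (u v : T -> R[i]) : csummable u -> csummable v ->
  csum (fun x => u x - v x) = csum u - csum v.
Proof. by move=> us vs; rewrite csumD ?csumN//; exact: csummableN. Qed.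

Lemma csumJ T (u : T -> R[i]) : csum (fun x => (u x)^*) = (csum u)^*.
Proof.
apply/eqP; rewrite eq_complex/= -rsumN.
by apply/andP; split; apply/eqP/eq_rsum => x; case: (u x).
Qed.

Lemma csumZ T c (u : T -> R[i]) : csummable u ->
  csum (fun x => c * u x) = c * csum u.
Proof.
move=> us; have [ur ui] := csummable_ReIm us.
have rZ d (w : T -> R) : rsummable w -> rsummable (fun x => d * w x).
  move=> ws; rewrite /rsummable.
  rewrite (@eq_nsum _ _ _ (fun x => `|d| * `|w x|)); last by move=> x; rewrite normrM.
  by rewrite nsumZl// lte_mul_pinfty.
case: c => a b; apply/eqP; rewrite eq_complex/=.
apply/andP; split; apply/eqP.
  rewrite -!rsumZ// -rsumN -rsumD; last 2 first.
  - exact: rZ.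
  - rewrite /rsummable; under eq_nsum do rewrite normrN; exact: rZ.
  by apply: eq_rsum => x; case: (u x).
rewrite -!rsumZ// -rsumD; try exact: rZ.
by apply: eq_rsum => x; case: (u x).
Qed.

(** Rotating the sum S onto the positive half-line: |S|^2 is the sum of the real
    parts of conj S * u, hence at most |S| times the sum of the moduli.  This keeps
    the constant 1, which splitting into real and imaginary parts would lose. *)
Lemma csum_norm T (u : T -> R[i]) :
  ((normc (csum u))%:E <= nsum (fun x => normc (u x)))%E.
Proof.
have := leey (nsum (fun x => normc (u x))); rewrite le_eqVlt => /predU1P[->|us].
  by rewrite leey.
have nu0 x : 0 <= normc (u x) by exact: normc_ge0.
have := normc_ge0 (csum u); rewrite le_eqVlt => /predU1P[<-|S0].
  exact: nsum_ge0.
have : complex.Re (csum (fun x => (csum u)^* * u x)) = normc (csum u) ^+ 2.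
  by rewrite csumZ// mul_conjc.
rewrite /csum/= -/(csum u) => h.
have := rsum_le (fun x => complex.Re ((csum u)^* * u x)).
rewrite h => {}h.
have : ((normc (csum u) ^+ 2)%:E <= (normc (csum u))%:E * nsum (fun x => normc (u x)))%E.
  rewrite -nsumZl ?normc_ge0//; apply: (le_trans h); apply: le_nsum => x.
  by rewrite (le_trans (le_Re_normc _))// normcM normc_conj.
by rewrite (nsum_fin nu0 us) -EFinM !lee_fin expr2 ler_pM2l.
Qed.

Lemma csum_norm_le T (u : T -> R[i]) (v : T -> R) c :
  (forall x, normc (u x) <= v x) -> (nsum v <= c%:E)%E -> normc (csum u) <= c.
Proof.
move=> uv vc; rewrite -lee_fin (le_trans (csum_norm _))// (le_trans _ vc)//.
exact: le_nsum.
Qed.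

Lemma csum_inj (T1 T2 : choiceType) (e : T1 -> T2) (u : T2 -> R[i]) :
  injective e -> (forall y, (forall x, e x != y) -> u y = 0) ->
  csum u = csum (u \o e).
Proof.
move=> einj u0; rewrite /csum.
by rewrite (rsum_inj einj) 1?(rsum_inj einj)// => y /u0 ->.
Qed.

Lemma csum_unit (u : unit -> R[i]) : csum u = u tt.
Proof.
have h (w : unit -> R) : rsum w = w tt.
  wlog w0 : w / 0 <= w tt => [hw|].
    case: (lerP 0 (w tt)) => w0; first exact: hw.
    by rewrite -[LHS]opprK -rsumN hw ?opprK// oppr_ge0 ltW.
  by rewrite rsum_ge0 ?nsum_unit// => -[].
by rewrite /csum !h; case: (u tt).
Qed.

Lemma csum_delta T (u : T -> R[i]) a : (forall x, x != a -> u x = 0) ->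
  csum u = u a.
Proof.
move=> u0; rewrite (@csum_inj unit T (fun=> a)).
- by rewrite csum_unit.
- by move=> [] [].
- by move=> y /(_ tt); rewrite eq_sym => /u0.
Qed.

Lemma csummable_delta T (u : T -> R[i]) a : (forall x, x != a -> u x = 0) ->
  csummable u.
Proof.
move=> u0; rewrite /csummable (@nsum_delta _ _ _ a) ?normc_ge0 ?ltry//.
by move=> x /u0 ->; rewrite normc0.
Qed.

Lemma csum_pair (T1 T2 : choiceType) (u : T1 -> T2 -> R[i]) :
  (\esum_(x in [set: T1]) nsum (fun y => normc (u x y)) < +oo)%E ->
  csum (fun xy : T1 * T2 => u xy.1 xy.2) = csum (fun x => csum (u x)).
Proof.
move=> us; rewrite /csum.
rewrite (rsum_pair (u := fun x y => complex.Re (u x y))); last first.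
  apply: le_lt_trans us; apply: le_esum => x _; apply: le_nsum => y.
  exact: le_Re_normc.
rewrite (rsum_pair (u := fun x y => complex.Im (u x y)))//.
apply: le_lt_trans us; apply: le_esum => x _; apply: le_nsum => y.
exact: le_Im_normc.
Qed.

Lemma csum_fubini (T1 T2 : choiceType) (u : T1 -> T2 -> R[i]) :
  (\esum_(x in [set: T1]) nsum (fun y => normc (u x y)) < +oo)%E ->
  csum (fun x => csum (u x)) = csum (fun y => csum (fun x => u x y)).
Proof.
move=> us; rewrite -csum_pair// -csum_pair; last first.
  by rewrite -nsum_fubini// => x y; exact: normc_ge0.
rewrite (@csum_inj (T2 * T1)%type (T1 * T2)%type (fun p => (p.2, p.1)))//.
  by move=> [x y] [x' y'] [-> ->].
by move=> [x y] /(_ (y, x)); rewrite eqxx.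
Qed.

Lemma csummable_iter (T1 T2 : choiceType) (u : T1 -> T2 -> R[i]) :
  (\esum_(x in [set: T1]) nsum (fun y => normc (u x y)) < +oo)%E ->
  (forall x, csummable (u x)) /\ csummable (fun x => csum (u x)).
Proof.
move=> us; have [ui us'] := nsum_iter_fin (fun x y => normc_ge0 (u x y)) us.
split=> //; apply: (csummable_le (v := fun x => fine (nsum (fun y => normc (u x y))))).
  move=> x; apply: (csum_norm_le (v := fun y => normc (u x y))) => //.
  by rewrite -nsum_fin// => y; exact: normc_ge0.
by rewrite us'.
Qed.

Lemma nsum_recl (u : nat -> R) : (forall n, 0 <= u n) ->
  nsum u = ((u 0%N)%:E + nsum (u \o S))%E.
Proof.
move=> u0.
rewrite (@eq_nsum _ _ _ (fun n => (if n == 0%N then u 0%N else 0) + (if n == 0%N then 0 else u n))).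
  rewrite nsumD; last 2 first.
  - by case=> [|n] /=.
  - by case=> [|n] /=.
  congr (_ + _)%E; first by rewrite (@nsum_delta _ _ _ 0%N)//= => -[].
  rewrite (@nsum_inj _ _ _ S)//; first exact: succn_inj.
  by case=> // n /(_ n); rewrite eqxx.
by case=> [|n] /=; rewrite ?addr0 ?add0r.
Qed.

Lemma csum_recl (u : nat -> R[i]) : csummable u ->
  csum u = u 0%N + csum (u \o S).
Proof.
move=> us.
have s0 : csummable (fun n : nat => if n == 0%N then u 0%N else 0).
  by apply: (@csummable_delta _ _ 0%N) => -[].
rewrite (@eq_csum _ _ (fun n => (if n == 0%N then u 0%N else 0) + (if n == 0%N then 0 else u n))).
  rewrite csumD//; last first.
    apply: le_lt_trans us; apply: le_nsum => -[|n] /=; rewrite ?normc0 ?normc_ge0//.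
    by rewrite expr0n /= addr0 sqrtr0 normc_ge0.
  congr (_ + _); first by rewrite (@csum_delta _ _ 0%N)//; case.
  rewrite (@csum_inj _ _ S)//; first exact: succn_inj.
  by case=> // n /(_ n); rewrite eqxx.
by case=> [|n] /=; rewrite ?addr0 ?add0r.
Qed.

Lemma csum_ord (u : nat -> R[i]) n : (forall k, (n <= k)%N -> u k = 0) ->
  csummable u /\ csum u = \sum_(k < n) u k.
Proof.
elim: n u => [|n ih] u u0.
  split; last by rewrite big_ord0 csum0// => k; exact: u0.
  by rewrite /csummable nsum0 ?ltry// => k; rewrite u0// normc0.
have [|ss se] := ih (u \o S); first by move=> k nk; exact: u0.
have us : csummable u.
  rewrite /csummable nsum_recl; last by move=> k; exact: normc_ge0.
  by rewrite lte_add_pinfty// ltry.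
by split => //; rewrite csum_recl// se big_ord_recl.
Qed.

End ComplexSums.

(** * Jensen's inequality and the norms of l^p *)

Section Jensen.
Variable R : realType.

(** The power function lies above its tangent at t; this is Young's inequality for
    the conjugate exponents r and r / (r - 1). *)
Lemma young_tangent (r t u : R) : 1 <= r -> 0 <= t -> 0 <= u ->
  r * t `^ (r - 1) * u <= u `^ r + (r - 1) * t `^ r.
Proof.
move=> r1 t0 u0; have [->|rN1] := eqVneq r 1.
  by rewrite subrr powRr0 !mul1r mul0r addr0 powRr1.
have r_gt1 : 1 < r by rewrite lt_neqAle eq_sym rN1.
have r0 : 0 < r by lra.
have q0 : 0 < r / (r - 1) by rewrite divr_gt0// subr_gt0.
have q1 : r^-1 + (r / (r - 1))^-1 = 1 by field; lra.
have := conjugate_powR u0 (powR_ge0 t (r - 1)) r0 q0 q1.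
rewrite -powRrM [(r - 1) * _](_ : _ = r); last by field; lra.
move=> /(ler_wpM2l (ltW r0)); rewrite mulrDr.
rewrite [r * (u `^ r / r)](_ : _ = u `^ r); last by field; lra.
rewrite [r * (_ / _)](_ : _ = (r - 1) * t `^ r); last by field; lra.
by rewrite -mulrA [_ * u]mulrC.
Qed.

(** Sum the tangent inequality against w and take the tangent at s / W, where s is
    the sum of w u; for W the total mass of w this is the average of u. *)
Lemma jensen_powR (T : choiceType) (w u : T -> R) (r W V : R) :
  1 <= r -> 0 < W -> (forall i, 0 <= w i) -> (forall i, 0 <= u i) ->
  (nsum w <= W%:E)%E -> (nsum (fun i => (w i * u i `^ r)%R) <= V%:E)%E ->
  exists s, [/\ 0 <= s, nsum (fun i => w i * u i) = s%:E &
                s `^ r <= W `^ (r - 1) * V].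
Proof.
move=> r1 W0 w0 u0 wW uV.
have wu0 i : 0 <= w i * u i by exact: mulr_ge0.
have wur0 i : 0 <= w i * u i `^ r by rewrite mulr_ge0// powR_ge0.
have key t : 0 <= t ->
    ((r * t `^ (r - 1))%:E * nsum (fun i => (w i * u i)%R) <=
     (V + ((r - 1) * t `^ r) * W)%:E)%E.
  move=> t0; have rt0 : 0 <= (r - 1) * t `^ r by rewrite mulr_ge0 ?powR_ge0 ?subr_ge0.
  rewrite -nsumZl//; last by rewrite mulr_ge0 ?powR_ge0//; lra.
  apply: (@le_trans _ _ (nsum (fun i => w i * u i `^ r + ((r - 1) * t `^ r) * w i))).
    apply: le_nsum => i; have := ler_wpM2l (w0 i) (young_tangent r1 t0 (u0 i)).
    by rewrite mulrDr [w i * ((r - 1) * _)]mulrC mulrCA.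
  rewrite nsumD//; last by move=> i; rewrite mulr_ge0.
  rewrite nsumZl// EFinD leeD// [X in (_ <= X)%E]EFinM.
  by rewrite lee_wpmul2l// lee_fin.
(* The tangent at 1 already bounds the sum, so that s is finite. *)
have [s0 sE] : exists s0, nsum (fun i => w i * u i) = s0%:E.
  have := key 1 ler01; rewrite !powR1 mulr1 => h.
  have fin : (nsum (fun i => (w i * u i)%R) < +oo)%E.
    rewrite ltNge leye_eq; apply/negP => /eqP e; move: h.
    by rewrite e gt0_muley ?lte_fin ?leye_eq//; lra.
  by exists (fine (nsum (fun i => w i * u i))); exact: nsum_fin.
have s_ge0 : 0 <= s0 by rewrite -lee_fin -sE nsum_ge0.
exists s0; split => //.
set t := s0 / W; have t0 : 0 <= t by rewrite divr_ge0// ltW.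
have := key t t0; rewrite sE -EFinM lee_fin.
have sW : s0 = t * W by rewrite /t divfK// gt_eqF.
rewrite {1}sW mulrA -[r * _ * t]mulrA [_ * t]mulrC mulr_powRB1//; last by lra.
move=> h; have {}h : t `^ r * W <= V by lra.
rewrite sW powRM// ?(ltW W0)// -(mulr_powRB1 (ltW W0)); last by lra.
by rewrite mulrA mulrC ler_wpM2l// powR_ge0.
Qed.

End Jensen.

Section LpNorms.
Variables (R : realType) (X : countType) (m : X -> R).
Hypothesis m_gt0 : forall x, 0 < m x.
Implicit Types (f g : X -> R[i]) (r C : R) (p : \bar R).

Let powm_ge0 r f x : 0 <= normc (f x) `^ r * m x.
Proof. by rewrite mulr_ge0 ?powR_ge0// ltW. Qed.

Lemma lnorm_ge0 p f : (0 <= lnorm m p f)%E.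
Proof.
case: p => [r||] //=; first exact: poweR_ge0.
by rewrite le_max lexx.
Qed.

Lemma lnorm_finP r C f : 1 <= r -> 0 <= C ->
  (lnorm m r%:E f <= C%:E)%E <->
  (nsum (fun x => (normc (f x) `^ r * m x)%R) <= (C `^ r)%:E)%E.
Proof.
move=> r1 C0 /=; rewrite -/(nsum (fun x => normc (f x) `^ r * m x)).
have r0 : 0 < r by lra.
have := nsum_ge0 (powm_ge0 r f).
case: (nsum _) => [e||] //=; last by rewrite gt_eqF ?invr_gt0// => _; split.
rewrite !lee_fin => e0; split => h.
  have -> : e = (e `^ r^-1) `^ r by rewrite -powRrM mulVf ?powRr1// gt_eqF.
  by rewrite ge0_ler_powR ?nnegrE ?powR_ge0// ltW.
have -> : C = (C `^ r) `^ r^-1 by rewrite -powRrM mulfV ?powRr1// gt_eqF.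
by rewrite ge0_ler_powR ?nnegrE ?powR_ge0// invr_ge0 ltW.
Qed.

Lemma lnorm_yP C f : 0 <= C ->
  (lnorm m +oo f <= C%:E)%E <-> (forall x, normc (f x) <= C).
Proof.
move=> C0 /=; rewrite ge_max lee_fin C0 /=; split.
  move=> h x; rewrite -lee_fin (le_trans _ h)//; apply: ereal_sup_ubound.
  by exists x.
by move=> h; apply: ge_ereal_sup => _ [x _ <-]; rewrite lee_fin.
Qed.

Lemma lp_bound p f : lp m p f -> exists2 C, 0 <= C & lnorm m p f = C%:E.
Proof.
move=> fp; have f0 := lnorm_ge0 p f; exists (fine (lnorm m p f)).
  exact: fine_ge0.
by rewrite fineK// ge0_fin_numE.
Qed.

Lemma bound_lp p f C : (lnorm m p f <= C%:E)%E -> lp m p f.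
Proof. by move=> h; apply: le_lt_trans h _; rewrite ltry. Qed.

(** Statements uniform in the exponent are proved separately for real exponents and
    for the supremum norm. *)
Lemma exponent_ind (P : \bar R -> Prop) :
  (forall r, 1 <= r -> P r%:E) -> P +oo%E -> forall p, (1 <= p)%E -> P p.
Proof. by move=> Pr Py; case=> [r| |]// r1; apply: Pr. Qed.

Lemma le_lnorm p f g C : (1 <= p)%E -> 0 <= C ->
  (forall x, normc (f x) <= normc (g x)) ->
  (lnorm m p g <= C%:E)%E -> (lnorm m p f <= C%:E)%E.
Proof.
move=> p1 C0 fg; move: p p1; apply: exponent_ind => [r r1|].
  rewrite !lnorm_finP//; apply: le_trans; apply: le_nsum => x.
  rewrite ler_wpM2r ?(ltW (m_gt0 x))// ge0_ler_powR ?nnegrE ?normc_ge0//.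
  by rewrite (le_trans _ r1).
by rewrite !lnorm_yP// => h x; rewrite (le_trans (fg x)).
Qed.

Lemma eq_lnorm p f g : (forall x, normc (f x) = normc (g x)) ->
  lnorm m p f = lnorm m p g.
Proof.
move=> fg; case: p => [r| |] //=.
  by congr (_ `^ _)%E; apply: eq_esum => x _; rewrite fg.
by congr (maxe _ (ereal_sup _)); apply: eq_imagel => x _; rewrite fg.
Qed.

Lemma eq_lnorm_le p f g B : f =1 g ->
  (lnorm m p f <= B)%E -> (lnorm m p g <= B)%E.
Proof. by move=> /funext ->. Qed.

(** Evaluation at a point is bounded on l^p since every point has positive mass.
    This lets limits in l^p be identified pointwise, and sums be formed pointwise. *)
Lemma lnorm_point p x : (1 <= p)%E -> exists2 K, 0 <= K &
  forall f C, 0 <= C -> (lnorm m p f <= C%:E)%E -> normc (f x) <= K * C.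
Proof.
move=> p1; move: p p1; apply: exponent_ind => [r r1|]; last first.
  by exists 1 => // f C C0; rewrite lnorm_yP// mul1r.
have r0 : 0 < r by lra.
exists ((m x)^-1 `^ r^-1); first exact: powR_ge0.
move=> f C C0; rewrite lnorm_finP// => h.
have := le_trans (nsum_term x (powm_ge0 r f)) h; rewrite lee_fin => {}h.
have -> : normc (f x) = (normc (f x) `^ r) `^ r^-1.
  by rewrite -powRrM mulfV ?powRr1 ?normc_ge0// gt_eqF.
have -> : C = (C `^ r) `^ r^-1 by rewrite -powRrM mulfV ?powRr1// gt_eqF.
rewrite -powRM ?invr_ge0 ?powR_ge0// ?(ltW (m_gt0 x))//.
rewrite ge0_ler_powR ?nnegrE ?invr_ge0 ?powR_ge0// ?(ltW r0)//.
  by rewrite mulr_ge0 ?powR_ge0// invr_ge0 ltW.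
by rewrite ler_pdivlMl// mulrC.
Qed.

(** Common core of the two l^p bounds for finite p: applied to the transition
    kernel it bounds P, applied to a summable sequence of coefficients it bounds an
    infinite linear combination of functions. *)
Lemma csum_jensen (T : choiceType) (h : X -> T -> R[i]) (k g : X -> T -> R) r W V :
  1 <= r -> 0 < W -> (forall x i, 0 <= k x i) -> (forall x i, 0 <= g x i) ->
  (forall x i, normc (h x i) <= k x i * g x i) ->
  (forall x, (nsum (k x) <= W%:E)%E) ->
  (\esum_(x in [set: X]) nsum (fun i => (m x * (k x i * g x i `^ r))%R) <= V%:E)%E ->
  (forall x, csummable (h x)) /\
  (nsum (fun x => (normc (csum (h x)) `^ r * m x)%R) <= (W `^ (r - 1) * V)%:E)%E.
Proof.
move=> r1 W0 k0 g0 hkg kW gV.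
have r0 : 0 <= r by lra.
have kg0 x i : 0 <= k x i * g x i `^ r by rewrite mulr_ge0 ?powR_ge0.
have mkg0 x i : 0 <= m x * (k x i * g x i `^ r) by rewrite mulr_ge0// ltW.
have [fin tot] := nsum_iter_fin mkg0 (le_lt_trans gV (ltry V)).
have mnu x := nsumZl (ltW (m_gt0 x)) (kg0 x).
have vfin x : (nsum (fun i => (k x i * g x i `^ r)%R) < +oo)%E.
  move: (fin x); rewrite mnu => {}fin.
  rewrite ltNge leye_eq; apply/negP => /eqP e; move: fin.
  by rewrite e gt0_muley ?ltxx ?lte_fin.
pose v x := fine (nsum (fun i => (k x i * g x i `^ r)%R)).
have vE x : nsum (fun i => (k x i * g x i `^ r)%R) = (v x)%:E by exact: nsum_fin.
have J x : exists s, [/\ 0 <= s, nsum (fun i => k x i * g x i) = s%:E &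
                s `^ r <= W `^ (r - 1) * v x].
  by apply: jensen_powR => //; rewrite vE.
split=> [x|].
  have [s [_ se _]] := J x.
  by apply: (csummable_le (hkg x)); rewrite se ltry.
apply: (@le_trans _ _ (nsum (fun x => W `^ (r - 1) * (m x * v x)))).
  apply: le_nsum => x; have [s [s0 se sr]] := J x.
  rewrite mulrCA mulrC ler_wpM2l ?(ltW (m_gt0 x))//; apply: le_trans sr.
  rewrite ge0_ler_powR ?nnegrE ?normc_ge0//.
  by apply: (csum_norm_le (hkg x)); rewrite se.
rewrite nsumZl ?powR_ge0//; last first.
  by move=> x; rewrite mulr_ge0 ?(ltW (m_gt0 x))// fine_ge0// nsum_ge0.
rewrite EFinM lee_wpmul2l ?lee_fin ?powR_ge0//; apply: le_trans gV.
rewrite -tot; apply: le_nsum => x.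
by rewrite mnu vE -EFinM.
Qed.

(** The triangle inequality for infinite combinations, the convergence being
    pointwise. *)
Lemma lnorm_average p (a : nat -> R[i]) (F : nat -> X -> R[i]) A C :
  (1 <= p)%E -> 0 < A -> 0 <= C ->
  (nsum (fun n => normc (a n)) <= A%:E)%E ->
  (forall n, (lnorm m p (F n) <= C%:E)%E) ->
  (forall x, csummable (fun n => a n * F n x)) /\
  (lnorm m p (fun x => csum (fun n => a n * F n x)%R) <= (A * C)%:E)%E.
Proof.
move=> p1 A0 C0 aA; have a0 n := normc_ge0 (a n).
move: p p1; apply: exponent_ind => [r r1|] FC.
  have FC' n : (nsum (fun x => (normc (F n x) `^ r * m x)%R) <= (C `^ r)%:E)%E.
    exact/lnorm_finP.
  rewrite lnorm_finP// ?mulr_ge0 ?(ltW A0)//.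
  have -> : (A * C) `^ r = A `^ (r - 1) * (A * C `^ r).
    rewrite powRM ?(ltW A0)// mulrA [_ * A]mulrC mulr_powRB1 ?(ltW A0)//; lra.
  apply: (csum_jensen (k := fun _ n => normc (a n)) (g := fun x n => normc (F n x))) => //.
  - by move=> *; exact: normc_ge0.
  - by move=> x n; rewrite normcM.
  have pos x n : 0 <= m x * (normc (a n) * normc (F n x) `^ r).
    by rewrite !mulr_ge0 ?powR_ge0// ltW.
  rewrite nsum_fubini//.
  apply: (@le_trans _ _ ((\esum_(n in [set: nat]) ((C `^ r)%:E * (normc (a n))%:E))))%E.
    apply: le_esum => n _.
    rewrite (@eq_nsum _ _ _ (fun x => normc (a n) * (normc (F n x) `^ r * m x))).
      by rewrite nsumZl// muleC; apply: lee_wpmul2r; rewrite ?lee_fin.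
    by move=> x; rewrite mulrCA [m x * _]mulrC.
  rewrite esumZl ?powR_ge0// EFinM muleC.
  by apply: lee_wpmul2r; rewrite ?lee_fin ?powR_ge0.
have FC' n x : normc (F n x) <= C by have /lnorm_yP := FC n; exact.
have le x n : normc (a n * F n x) <= C * normc (a n).
  by rewrite normcM mulrC ler_wpM2r.
have fin : (nsum (fun n => C * normc (a n))%R <= (A * C)%:E)%E.
  by rewrite nsumZl// mulrC EFinM lee_wpmul2l ?lee_fin.
split=> [x|].
  by apply: (csummable_le (le x)); apply: le_lt_trans fin _; rewrite ltry.
rewrite lnorm_yP ?mulr_ge0 ?(ltW A0)// => x.
exact: (csum_norm_le (le x)).
Qed.

Lemma lnorm_lin p c f g C : (1 <= p)%E -> 0 <= C ->
  (lnorm m p f <= C%:E)%E -> (lnorm m p g <= C%:E)%E ->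
  (lnorm m p (fun x => c * f x + g x)%R <= ((normc c + 1) * C)%:E)%E.
Proof.
move=> p1 C0 fC gC; have c0 := normc_ge0 c.
have c1 : 0 < normc c + 1 by rewrite ltr_wpDl.
(* The sum of two functions is an average over the weights c, 1, 0, 0, and so on. *)
pose a n : R[i] := if n is n'.+1 then (n' == 0%N)%:R else c.
pose F n := if n is _.+1 then g else f.
have aE : (nsum (fun n => normc (a n)) <= (normc c + 1)%:E)%E.
  rewrite nsum_recl; last by move=> n; exact: normc_ge0.
  rewrite (@nsum_delta _ _ _ 0%N); first 1 last.
  - exact: normc_ge0.
  - by move=> n /negbTE n0; rewrite /a /= n0 normc0.
  have n1 : normc (a 1%N) = 1 := normc1 R.
  by rewrite -[leLHS]/((normc c)%:E + (normc (a 1%N))%:E)%E n1.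
have FC n : (lnorm m p (F n) <= C%:E)%E by case: n.
have [_] := lnorm_average p1 c1 C0 aE FC.
congr (lnorm _ _ _ <= _)%E; apply/funext => x.
have sd (u : nat -> R[i]) : csummable (fun n : nat => (n == 0%N)%:R * u n).
  by apply: (@csummable_delta _ _ _ 0%N) => n /negbTE ->; rewrite mul0r.
rewrite csum_recl.
  by rewrite (@csum_delta _ _ _ 0%N) /= ?mul1r// => n /negbTE ->; rewrite mul0r.
rewrite /csummable nsum_recl; last by move=> n; exact: normc_ge0.
by rewrite lte_add_pinfty ?ltry//; exact: (sd (fun=> g x)).
Qed.

Lemma lp_lin p c f g : (1 <= p)%E -> lp m p f -> lp m p g ->
  lp m p (fun x => c * f x + g x).
Proof.
move=> p1 /lp_bound[C C0 fC] /lp_bound[D D0 gD].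
apply: (@bound_lp p _ ((normc c + 1) * (C + D))); apply: lnorm_lin => //.
- by rewrite addr_ge0.
- by rewrite fC lee_fin lerDl.
- by rewrite gD lee_fin lerDr.
Qed.

Lemma lnormZ p c f C : (1 <= p)%E -> 0 <= C -> (lnorm m p f <= C%:E)%E ->
  (lnorm m p (fun x => c * f x)%R <= (normc c * C)%:E)%E.
Proof.
move=> p1 C0 fC; have [->|c0] := eqVneq c 0.
  rewrite normc0 mul0r; move: p p1 fC; apply: exponent_ind => [r r1|] _.
    apply/lnorm_finP => //; rewrite nsum0 ?lee_fin ?powR_ge0// => x.
    by rewrite mul0r normc0 powR0 ?mul0r//; lra.
  by apply/lnorm_yP => // x; rewrite mul0r normc0.
have c1 : 0 < normc c.
  by rewrite lt_neqAle normc_ge0 andbT eq_sym; apply: contra c0 => /eqP/eq0_normc ->.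
have d (u : nat -> R[i]) n : n != 0%N -> (if n == 0%N then c else 0) * u n = 0.
  by move=> /negbTE ->; rewrite mul0r.
have [||_] := @lnorm_average p (fun n => if n == 0%N then c else 0) (fun=> f) _ C p1 c1 C0.
- rewrite (@nsum_delta _ _ _ 0%N) ?normc_ge0// => n /negbTE ->.
  by rewrite normc0.
- by [].
congr (lnorm _ _ _ <= _)%E; apply/funext => x.
by rewrite (csum_delta (a := 0%N))// => n; exact: (d (fun=> f x)).
Qed.

Lemma lp0 p : (1 <= p)%E -> lp m p (fun=> 0).
Proof.
move=> p1; apply: (@bound_lp p _ 0); move: p p1; apply: exponent_ind => [r r1|].
  apply/lnorm_finP => //; rewrite nsum0 ?lee_fin ?powR_ge0// => x.
  by rewrite normc0 powR0 ?mul0r//; lra.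
by apply/lnorm_yP => // x; rewrite normc0.
Qed.

Lemma finite_support_nsum (u : X -> R) (A : set X) : finite_set A ->
  (forall x, 0 <= u x) -> (forall x, ~ A x -> u x = 0) ->
  nsum u = (\sum_(x \in A) u x)%:E.
Proof.
move=> Af u0 uA; transitivity (\esum_(x in A) (u x)%:E)%E.
  rewrite esum_mkcond; apply: eq_esum => x _; case: ifPn => //.
  by rewrite notin_setE => /uA ->.
by rewrite esum_fset ?fsumEFin// => x _; rewrite lee_fin.
Qed.

Lemma Cc_lp p f : (1 <= p)%E -> Cc f -> lp m p f.
Proof.
move=> p1; rewrite /Cc /= => ff; move: p p1; apply: exponent_ind => [r r1|].
  have r0 : r != 0 by lra.
  have [S SE] : exists S, nsum (fun x => normc (f x) `^ r * m x) = S%:E.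
    eexists; apply: finite_support_nsum ff _ _; first exact: powm_ge0.
    by move=> x /negP; rewrite negbK => /eqP ->; rewrite normc0 powR0// mul0r.
  by rewrite /lp /= -/(nsum (fun x => normc (f x) `^ r * m x)) SE poweR_lty// ltry.
have [S SE] : exists S, nsum (fun x => normc (f x)) = S%:E.
  eexists; apply: finite_support_nsum ff _ _; first by move=> x; exact: normc_ge0.
  by move=> x /negP; rewrite negbK => /eqP ->; rewrite normc0.
have S0 : 0 <= S by rewrite -lee_fin -SE; apply: nsum_ge0 => x; exact: normc_ge0.
apply: (@bound_lp _ _ S); apply/lnorm_yP => // x.
rewrite -lee_fin -SE; apply: (nsum_term x (u := fun x => normc (f x))).
by move=> y; exact: normc_ge0.
Qed.

Lemma Cc_delta x : Cc (fun y : X => (y == x)%:R : R[i]).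
Proof.
apply: (@sub_finite_set _ _ [set x]); last exact: finite_set1.
by move=> y /=; case: (y =P x) => // _; rewrite eqxx.
Qed.

(** Finite subsums of |f|^r m come within e^r of the total, and truncating f to the
    corresponding finite set leaves only the tail. *)
Lemma Cc_dense r f e : 1 <= r -> lp m r%:E f -> 0 < e ->
  exists2 phi, Cc phi & (lnorm m r%:E (f - phi)%R <= e%:E)%E.
Proof.
move=> r1 fp e0; have rN0 : r != 0 by lra.
pose u x := normc (f x) `^ r * m x; have u0 x : 0 <= u x by exact: powm_ge0.
have ufin : nsum u \is a fin_num.
  have [C C0 fC] := lp_bound fp.
  rewrite ge0_fin_numE ?nsum_ge0//; apply: (@le_lt_trans _ _ (C `^ r)%:E); last exact: ltry.
  by apply/lnorm_finP => //; rewrite fC.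
have er0 : 0 < e `^ r by exact: powR_gt0.
have [_ [A [Af _]] <- hA] := ub_ereal_sup_adherent er0 ufin.
exists (fun x => if x \in A then f x else 0).
  apply: sub_finite_set Af => x /=; case: ifPn; last by rewrite eqxx.
  by rewrite inE.
apply/lnorm_finP; [by []|exact: ltW|].
rewrite (@eq_nsum _ _ _ (fun x => if x \in A then 0 else u x)); last first.
  move=> x; rewrite !fctE /=; case: ifPn => _; last by rewrite subr0.
  by rewrite subrr normc0 powR0// mul0r.
set v := fun x => _.
pose w x := if x \in A then u x else 0.
have v0 x : 0 <= v x by rewrite /v; case: ifP.
have w0 x : 0 <= w x by rewrite /w; case: ifP.
have wE : (\sum_(x \in A) (u x)%:E)%E = nsum w.
  rewrite -esum_fset//; last by move=> x _; rewrite lee_fin.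
  rewrite esum_mkcond; apply: eq_esum => x _.
  by rewrite /w; case: ifP.
have uE : nsum u = (nsum w + nsum v)%E.
  rewrite -nsumD//; apply: eq_nsum => x.
  by rewrite /w /v; case: ifP; rewrite ?addr0 ?add0r.
move: hA ufin; rewrite -[ereal_sup _]/(nsum u) wE uE.
have := nsum_ge0 v0; have := nsum_ge0 w0.
case: (nsum w) => [a| |]//; case: (nsum v) => [b| |]//.
move=> _ _ h _; rewrite lee_fin; have : a + b - e `^ r < a := h; lra.
Qed.

End LpNorms.

(** * The transition operator and its power series *)

Section NormalizedGraph.
Variables (R : realType) (X : countType) (G : graph R X) (m : X -> R).
Hypothesis m_gt0 : forall x, 0 < m x.
Hypothesis m_deg : forall x, m x = degree G x.
Implicit Types (f g : X -> R[i]) (C : R) (p : \bar R).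

Let b_ge0 x y : 0 <= gb G x y := gb_ge0 G x y.

Lemma nsum_edges x : nsum (gb G x) = (m x)%:E.
Proof.
rewrite m_deg /degree -/(nsum (gb G x)) -nsum_fin//.
exact: (gb_summable G x).
Qed.

(** The measure m is invariant for the random walk. *)
Lemma nsum_edge_weight (u : X -> R) : (forall x, 0 <= u x) ->
  (\esum_(x in [set: X]) nsum (fun y => (gb G x y * u y)%R) =
   nsum (fun x => (m x * u x)%R))%E.
Proof.
move=> u0; rewrite nsum_fubini; last by move=> x y; rewrite mulr_ge0.
apply: eq_esum => y _.
rewrite (@eq_nsum _ _ _ (fun x => u y * gb G y x)); last first.
  by move=> x; rewrite mulrC gb_sym.
by rewrite nsumZl// nsum_edges mulrC.
Qed.

(** The transition operator P of the random walk, so that L = 1 - P. *)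
Definition averaging f : X -> R[i] :=
  fun x => csum (fun y => (gb G x y / m x)%:C * f y).

Local Notation mean := averaging.

Let k_ge0 x y : 0 <= gb G x y / m x.
Proof. by rewrite divr_ge0// ltW. Qed.

Lemma nsum_transition x : nsum (fun y => gb G x y / m x) = 1%E.
Proof.
rewrite (@eq_nsum _ _ _ (fun y => (m x)^-1 * gb G x y)); last by move=> y; rewrite mulrC.
by rewrite nsumZl ?invr_ge0 ?(ltW (m_gt0 x))// nsum_edges -EFinM mulVf// gt_eqF.
Qed.

Lemma normc_transition x y f :
  normc ((gb G x y / m x)%:C * f y) = gb G x y / m x * normc (f y).
Proof. by rewrite normcM normc_real ger0_norm. Qed.

(** For finite p, Jensen's inequality bounds |P f|^p by P |f|^p, and the invariance
    of m bounds the total mass of the latter. *)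
Lemma mean_bound p f C : (1 <= p)%E -> 0 <= C -> (lnorm m p f <= C%:E)%E ->
  (forall x, csummable (fun y => (gb G x y / m x)%:C * f y)) /\
  (lnorm m p (mean f) <= C%:E)%E.
Proof.
move=> p1 C0; move: p p1; apply: exponent_ind => [r r1|] fC.
  have := @csum_jensen R X m m_gt0 X (fun x y => (gb G x y / m x)%:C * f y)
     (fun x y => gb G x y / m x) (fun x y => normc (f y)) r 1 (C `^ r) r1 ltr01 k_ge0.
  case=> [x y|x y|x||sm]; first exact: normc_ge0.
  - by rewrite normc_transition.
  - by rewrite nsum_transition.
  - move/lnorm_finP: fC => /(_ m_gt0 r1 C0); apply: le_trans.
    have e : (\esum_(x in [set: X]) nsum (fun y => (m x * (gb G x y / m x * normc (f y) `^ r))%R) =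
       \esum_(x in [set: X]) nsum (fun y => (gb G x y * normc (f y) `^ r)%R))%E.
      apply: eq_esum => x _; apply: eq_nsum => y.
      by rewrite !mulrA [m x * gb G x y]mulrC mulfK// gt_eqF.
    rewrite e nsum_edge_weight; last by move=> x; exact: powR_ge0.
    by apply: le_nsum => x; rewrite mulrC.
  by rewrite powR1 mul1r => h; split => //; apply/lnorm_finP.
have {}fC : forall x, normc (f x) <= C by apply/(lnorm_yP m f C0).
have le x y : normc ((gb G x y / m x)%:C * f y) <= C * (gb G x y / m x).
  by rewrite normc_transition mulrC ler_wpM2r.
have s x : (nsum (fun y => C * (gb G x y / m x))%R <= C%:E)%E.
  by rewrite nsumZl// nsum_transition mule1.
split=> [x|]; first by apply: (csummable_le (le x)); apply: le_lt_trans (s x) _; rewrite ltry.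
by apply/lnorm_yP => // x; apply: csum_norm_le (le x) (s x).
Qed.

Lemma iter_mean_bound p f C n : (1 <= p)%E -> 0 <= C ->
  (lnorm m p f <= C%:E)%E -> (lnorm m p (iter n mean f) <= C%:E)%E.
Proof.
by move=> p1 C0 fC; elim: n => // n ih /=; case: (mean_bound p1 C0 ih).
Qed.

Lemma csum_nonneg (T : choiceType) (u : T -> R) : (forall x, 0 <= u x) ->
  csum (fun x => (u x)%:C) = (fine (nsum u))%:C.
Proof. by move=> u0; rewrite /csum /= rsum_ge0// rsum0. Qed.

(** The sum on the left is P |f| at x, so the bound on P applies to it; the constant
    is uniform in f, which justifies exchanging P with infinite series. *)
Lemma mean_abs p x : (1 <= p)%E -> exists2 K, 0 <= K &
  forall f C, 0 <= C -> (lnorm m p f <= C%:E)%E ->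
  (nsum (fun y => normc ((gb G x y / m x)%:C * f y)%R) <= (K * C)%:E)%E.
Proof.
move=> p1; have [K K0 Kp] := lnorm_point m_gt0 x p1; exists K => // f C C0 fC.
have afC : (lnorm m p (fun y => (normc (f y))%:C) <= C%:E)%E.
  apply: le_lnorm fC => // y.
  by rewrite normc_real ger0_norm// normc_ge0.
have [_ /(Kp _ _ C0)] := mean_bound p1 C0 afC.
have [/(_ x) s _] := mean_bound p1 C0 fC.
rewrite /averaging (@eq_csum _ _ _ (fun y => (normc ((gb G x y / m x)%:C * f y))%:C)); last first.
  by move=> y; rewrite normc_transition [RHS]rmorphM.
rewrite csum_nonneg; last by move=> y; exact: normc_ge0.
rewrite normc_real ger0_norm; last first.
  by rewrite fine_ge0// nsum_ge0// => y; exact: normc_ge0.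
by rewrite (nsum_fin _ s) ?lee_fin// => y; exact: normc_ge0.
Qed.

Lemma meanD p f g : (1 <= p)%E -> lp m p f -> lp m p g ->
  mean (fun x => f x + g x) = (fun x => mean f x + mean g x).
Proof.
move=> p1 /lp_bound[C C0 fC] /lp_bound[D D0 gD].
have fC' : (lnorm m p f <= C%:E)%E by rewrite fC.
have gD' : (lnorm m p g <= D%:E)%E by rewrite gD.
have [sf _] := mean_bound p1 C0 fC'; have [sg _] := mean_bound p1 D0 gD'.
apply/funext => x; rewrite /averaging -csumD//; apply: eq_csum => y.
by rewrite mulrDr.
Qed.

Lemma meanZ p c f : (1 <= p)%E -> lp m p f ->
  mean (fun x => c * f x) = (fun x => c * mean f x).
Proof.
move=> p1 /lp_bound[C C0 fC].
have fC' : (lnorm m p f <= C%:E)%E by rewrite fC.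
have [sf _] := mean_bound p1 C0 fC'.
apply/funext => x; rewrite /averaging -csumZ//; apply: eq_csum => y.
by rewrite mulrCA.
Qed.

Lemma iter_mean_lin p c f g n : (1 <= p)%E -> lp m p f -> lp m p g ->
  iter n mean (fun x => c * f x + g x) =
  (fun x => c * iter n mean f x + iter n mean g x).
Proof.
move=> p1 fp gp; elim: n => //= n ->.
have lpi h : lp m p h -> lp m p (iter n mean h).
  by move=> /lp_bound[C C0 hC]; apply: (@bound_lp _ _ _ _ _ C); rewrite iter_mean_bound// hC.
have lpZ : lp m p (fun x => c * iter n mean f x).
  have := lp_lin m_gt0 c p1 (lpi _ fp) (lp0 m_gt0 p1).
  by congr (lp _ _ _); apply/funext => x; rewrite addr0.
by rewrite (meanD p1 lpZ (lpi _ gp)) (meanZ _ p1 (lpi _ fp)).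
Qed.

(** The functional calculus of the contraction P for absolutely summable
    coefficients: the heat semigroup and the Neumann series are both of this form. *)
Definition power_series (a : nat -> R[i]) f : X -> R[i] :=
  fun x => csum (fun n => a n * iter n mean f x).

Local Notation Phi := power_series.

Lemma power_series_bound p a A f C : (1 <= p)%E -> 0 < A -> 0 <= C ->
  (nsum (fun n => normc (a n)) <= A%:E)%E -> (lnorm m p f <= C%:E)%E ->
  (forall x, csummable (fun n => a n * iter n mean f x)) /\
  (lnorm m p (Phi a f) <= (A * C)%:E)%E.
Proof.
move=> p1 A0 C0 aA fC; apply: lnorm_average => // n.
exact: iter_mean_bound.
Qed.

Lemma csummable_bound (T : choiceType) (a : T -> R[i]) : csummable a ->
  exists2 A, 0 < A & (nsum (fun n => normc (a n)) <= A%:E)%E.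
Proof.
move=> s; have a0 n := normc_ge0 (a n).
exists (fine (nsum (fun n => normc (a n))) + 1).
  by rewrite ltr_wpDl// fine_ge0// nsum_ge0.
by rewrite {1}(nsum_fin a0 s) lee_fin lerDl.
Qed.

Lemma power_series_summable p a f x : (1 <= p)%E -> csummable a -> lp m p f ->
  csummable (fun n => a n * iter n mean f x).
Proof.
move=> p1 /csummable_bound[A A0 aA] /lp_bound[C C0 fC].
have [|s _] := power_series_bound p1 A0 C0 aA (f := f); first by rewrite fC.
exact: s.
Qed.

Lemma power_series_lp p a f : (1 <= p)%E -> csummable a -> lp m p f -> lp m p (Phi a f).
Proof.
move=> p1 /csummable_bound[A A0 aA] /lp_bound[C C0 fC].
have [|_ s] := power_series_bound p1 A0 C0 aA (f := f); first by rewrite fC.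
exact: bound_lp s.
Qed.

Lemma mean_lp p f : (1 <= p)%E -> lp m p f -> lp m p (mean f).
Proof.
move=> p1 /lp_bound[C C0 fC]; have [|_ s] := mean_bound p1 C0 (f := f).
  by rewrite fC.
exact: bound_lp s.
Qed.

Lemma mean_power_series p a f : (1 <= p)%E -> csummable a -> lp m p f ->
  mean (Phi a f) = Phi a (mean f).
Proof.
move=> p1 as_ fp; apply/funext => x.
have /csummable_bound[A A0 aA] := as_.
have /lp_bound[C C0 fC] := fp.
have [K K0 Kx] := mean_abs x p1.
rewrite /averaging /power_series.
rewrite (@eq_csum _ _ _ (fun y => csum (fun n =>
    (gb G x y / m x)%:C * (a n * iter n mean f y)))); last first.
  by move=> y; rewrite -csumZ//; exact: (power_series_summable _ p1).
rewrite -(@csum_fubini _ nat X (fun n y => (gb G x y / m x)%:C * (a n * iter n mean f y))).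
  apply: eq_csum => n; rewrite -iterSr iterS /averaging -csumZ.
    by apply: eq_csum => y; rewrite mulrCA.
  have [|s _] := @mean_bound p (iter n mean f) C p1 C0; last exact: s.
  by rewrite iter_mean_bound// fC.
apply: (@le_lt_trans _ _ (\esum_(n in [set: nat]) ((K * C)%:E * (normc (a n))%:E))%E).
  apply: le_esum => n _.
  rewrite (@eq_nsum _ _ _ (fun y => normc (a n) * normc ((gb G x y / m x)%:C * iter n mean f y))).
    rewrite nsumZl ?normc_ge0//; last by move=> y; exact: normc_ge0.
    rewrite muleC; apply: lee_wpmul2r; rewrite ?lee_fin ?normc_ge0//.
    by apply: Kx => //; rewrite iter_mean_bound// fC.
  by move=> y; rewrite -normcM mulrCA.
have KC : 0 <= K * C by rewrite mulr_ge0.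
rewrite esumZl//; last by move=> n; rewrite lee_fin normc_ge0.
by apply: lte_mul_pinfty; rewrite ?lee_fin//; exact: as_.
Qed.

Lemma iter_mean_lp p f n : (1 <= p)%E -> lp m p f -> lp m p (iter n mean f).
Proof. by move=> p1 fp; elim: n => //= n; exact: mean_lp. Qed.

Lemma iter_mean_power_series p a f k : (1 <= p)%E -> csummable a -> lp m p f ->
  iter k mean (Phi a f) = Phi a (iter k mean f).
Proof.
move=> p1 as_ fp; elim: k => //= k ->.
by rewrite (mean_power_series p1)//; exact: iter_mean_lp.
Qed.

(** The coefficients of the product are the Cauchy product; the rearrangement of the
    double series is absolute because |P^n f(x)| is bounded in n. *)
Lemma power_series_comp p a b f : (1 <= p)%E -> csummable a -> csummable b -> lp m p f ->
  Phi a (Phi b f) = Phi (fun j => \sum_(k < j.+1) a k * b (j - k)%N) f.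
Proof.
move=> p1 as_ bs fp; apply/funext => x.
have /csummable_bound[A A0 aA] := as_.
have /csummable_bound[B B0 bB] := bs.
have /lp_bound[C C0 fC] := fp.
have [K K0 Kx] := lnorm_point m_gt0 x p1.
have Fx n : normc (iter n mean f x) <= K * C.
  by apply: Kx => //; rewrite iter_mean_bound// fC.
have KC : 0 <= K * C by rewrite mulr_ge0.
(* Terms indexed by the power j of P and the first index k. *)
pose u k j := if (k <= j)%N then a k * b (j - k)%N * iter j mean f x else 0.
have uin k : csum (u k) = csum (fun n => a k * (b n * iter (n + k) mean f x)).
  rewrite (@csum_inj _ _ _ (addn k))//.
  - by apply: eq_csum => n; rewrite /u /= leq_addr addKn addnC mulrA.
  - exact: addnI.
  by move=> j h; rewrite /u; case: leqP => // kj; have := h (j - k)%N; rewrite subnKC// eqxx.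
transitivity (csum (fun k => csum (u k))).
  apply: eq_csum => k; rewrite uin (iter_mean_power_series _ p1)// -csumZ.
    by apply: eq_csum => n; rewrite iterD.
  by apply: (power_series_summable _ p1) => //; exact: iter_mean_lp.
rewrite csum_fubini.
  apply: eq_csum => j; have [k jk|_ ->] := @csum_ord _ (fun k => u k j) j.+1.
    by rewrite /u leqNgt jk.
  rewrite mulr_suml; apply: eq_bigr => k _.
  by rewrite /u -ltnS ltn_ord.
apply: (@le_lt_trans _ _ (\esum_(k in [set: nat]) ((B * (K * C))%:E * (normc (a k))%:E))%E).
  apply: le_esum => k _.
  rewrite (@nsum_inj _ _ _ (addn k))//; first last.
  - move=> j h; rewrite /u; case: leqP; rewrite ?normc0// => kj.
    by have := h (j - k)%N; rewrite subnKC// eqxx.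
  - exact: addnI.
  apply: (@le_trans _ _ (nsum (fun n => (normc (a k) * (K * C)) * normc (b n)))).
    apply: le_nsum => n; rewrite /u /= leq_addr addKn !normcM.
    by rewrite mulrAC ler_wpM2r ?normc_ge0// ler_wpM2l ?normc_ge0.
  rewrite nsumZl ?mulr_ge0 ?normc_ge0//; last by move=> n; exact: normc_ge0.
  rewrite -EFinM [B * _ * _](_ : _ = normc (a k) * (K * C) * B); last by ring.
  by rewrite [X in (_ <= X)%E]EFinM lee_wpmul2l// lee_fin mulr_ge0 ?normc_ge0.
rewrite esumZl ?mulr_ge0 ?(ltW B0)//; last by move=> n; rewrite lee_fin normc_ge0.
by apply: lte_mul_pinfty; rewrite ?lee_fin ?mulr_ge0 ?(ltW B0).
Qed.

Lemma power_series_lin p a c f g : (1 <= p)%E -> csummable a -> lp m p f -> lp m p g ->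
  Phi a (fun x => c * f x + g x) = (fun x => c * Phi a f x + Phi a g x).
Proof.
move=> p1 as_ fp gp; apply/funext => x.
rewrite /power_series -csumZ; last exact: (power_series_summable _ p1).
rewrite -csumD; last 2 first.
- by apply: csummableZ; exact: (power_series_summable _ p1).
- exact: (power_series_summable _ p1).
by apply: eq_csum => n; rewrite (iter_mean_lin _ _ p1)// mulrDr mulrCA.
Qed.

Lemma power_series_lincoef p a b c f x : (1 <= p)%E -> csummable a -> csummable b ->
  lp m p f ->
  Phi (fun n => c * a n + b n) f x = c * Phi a f x + Phi b f x.
Proof.
move=> p1 as_ bs fp; rewrite /power_series -csumZ; last exact: (power_series_summable _ p1).
rewrite -csumD; last 2 first.
- by apply: csummableZ; exact: (power_series_summable _ p1).
- exact: (power_series_summable _ p1).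
by apply: eq_csum => n; rewrite mulrDl mulrA.
Qed.

End NormalizedGraph.

(** * The heat semigroup as a Poisson series *)

Section RightLimits.
Variable R : realType.
Implicit Type F : R -> \bar R.

Lemma right_cvg0P F : (forall t, (0 <= F t)%E) ->
  F t @[t --> 0^'+] --> 0%E <->
  (forall e, 0 < e -> exists2 d, 0 < d & forall t, 0 < t -> t < d -> (F t <= e%:E)%E).
Proof.
move=> F0; split => [Fc e e0|h].
  have : nbhs (0%E : \bar R) [set y | (y < e%:E)%E] by apply: open_ereal_lt'; rewrite lte_fin.
  move=> /Fc /nbhs_ballP[d /= d0 dF]; exists d => // t t0 td.
  by apply/ltW/(dF t) => //=; rewrite /ball/= sub0r normrN gtr0_norm.
move=> A /= [e /= e0 eA].
have [|d d0 dF] := h (e / 2); first by rewrite divr_gt0.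
apply/nbhs_ballP; exists d => //= t; rewrite /ball/= sub0r normrN => td t0.
have {}td : t < d by rewrite gtr0_norm in td.
have := dF t t0 td; have := F0 t; case: (F t) => [r| |]//.
rewrite !lee_fin => r0 re; apply: eA; rewrite /= sub0r normrN ger0_norm//.
by apply: le_lt_trans re _; rewrite ltr_pdivrMr//; lra.
Qed.

Lemma right_cvg0_linear F K : 0 <= K -> (forall t, (0 <= F t)%E) ->
  (forall t, 0 < t -> (F t <= (t * K)%:E)%E) -> F t @[t --> 0^'+] --> 0%E.
Proof.
move=> K0 F0 FK; apply/right_cvg0P => // e e0.
exists (e / (K + 1)); first by rewrite divr_gt0// ltr_wpDl.
move=> t t0; rewrite ltr_pdivlMr ?ltr_wpDl// => te.
apply: le_trans (FK t t0) _; rewrite lee_fin (le_trans _ (ltW te))//.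
by rewrite ler_wpM2l ?(ltW t0)// lerDl.
Qed.

End RightLimits.

Section Poisson.
Variable R : realType.
Implicit Type t : R.

Definition poisson_weight t (n : nat) : R := expR (- t) * (t ^+ n / n`!%:R).

Lemma poisson_weight_ge0 t n : 0 <= t -> 0 <= poisson_weight t n.
Proof. by move=> t0; rewrite mulr_ge0 ?expR_ge0// divr_ge0// exprn_ge0. Qed.

Lemma nsum_poisson t : 0 <= t -> nsum (poisson_weight t) = 1%E.
Proof.
move=> t0.
have c0 n : 0 <= exp_coeff t n by exact: exp_coeff_ge0.
have -> : nsum (poisson_weight t) = ((expR (- t))%:E * nsum (exp_coeff t))%E.
  by rewrite -nsumZl// expR_ge0.
rewrite /nsum -nneseries_esumT; last by move=> n; rewrite lee_fin.
rewrite (_ : (\sum_(i <oo) (exp_coeff t i)%:E)%E = (expR t)%:E).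
  by rewrite -EFinM -expRD addNr expR0.
rewrite /expR -EFin_lim; last exact: is_cvg_series_exp_coeff.
by apply/congr_lim/funext => n/=; rewrite /series/= -sumEFin.
Qed.

Lemma poisson_weight0 t : poisson_weight t 0 = expR (- t).
Proof. by rewrite /poisson_weight expr0 fact0 divr1 mulr1. Qed.

Lemma poisson_weight1 t : poisson_weight t 1 = t * expR (- t).
Proof. by rewrite /poisson_weight expr1 factS fact0 muln1 divr1 mulrC. Qed.

Lemma nsum_poisson1 t : 0 <= t ->
  nsum (fun n => poisson_weight t n.+1) = (1 - expR (- t))%:E.
Proof.
move=> t0; have p0 n := poisson_weight_ge0 n t0.
have fin : (nsum (fun n => poisson_weight t n.+1) < +oo)%E.
  apply: le_lt_trans (ltry 1); rewrite -(nsum_poisson t0) [leRHS]nsum_recl//.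
  by rewrite leeDr ?lee_fin.
have := nsum_recl p0; rewrite nsum_poisson// poisson_weight0.
rewrite (nsum_fin _ fin)// => -[e].
by rewrite (nsum_fin _ fin)//; congr _%:E; lra.
Qed.

(** The mass of the weights of index at least 2 is needed because the indices 0 and 1
    carry the subtracted terms of the generator. *)
Lemma nsum_poisson2 t : 0 <= t ->
  nsum (fun n => poisson_weight t n.+2) = (1 - expR (- t) - t * expR (- t))%:E.
Proof.
move=> t0; have p0 n := poisson_weight_ge0 n t0.
have p1 n : 0 <= poisson_weight t n.+1 by [].
have fin : (nsum (fun n => poisson_weight t n.+2) < +oo)%E.
  apply: le_lt_trans (ltry (1 - expR (- t))); rewrite -(nsum_poisson1 t0).
  by rewrite [leRHS]nsum_recl// leeDr ?lee_fin.
have := nsum_recl p1; rewrite nsum_poisson1// poisson_weight1.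
rewrite (nsum_fin _ fin)// => -[e].
by rewrite (nsum_fin _ fin)//; congr _%:E; lra.
Qed.

(** Poisson laws form a convolution semigroup, by the binomial theorem. *)
Lemma poisson_conv s t j :
  \sum_(k < j.+1) poisson_weight s k * poisson_weight t (j - k)%N =
  poisson_weight (s + t) j.
Proof.
rewrite /poisson_weight opprD expRD addrC exprDn mulr_suml mulr_sumr.
apply: eq_bigr => k _.
have kj : (k <= j)%N by rewrite -ltnS ltn_ord.
have n0 n : (n`!%:R : R) != 0 by rewrite pnatr_eq0 -lt0n fact_gt0.
rewrite -mulr_natl -(bin_fact kj) !natrM.
have b0 : ('C(j, k)%:R : R) != 0 by rewrite pnatr_eq0 -lt0n bin_gt0.
field; rewrite ?n0 ?b0//.
Qed.

Lemma poisson_weight_at0 n : poisson_weight 0 n = (n == 0%N)%:R.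
Proof.
rewrite /poisson_weight oppr0 expR0 mul1r; case: n => [|n].
  by rewrite expr0 fact0 divr1.
by rewrite expr0n mul0r.
Qed.

(** Coefficients of (1 - e^{-t(1-P)}) / t - (1 - P) as a power series in P. *)
Definition generator_error t (n : nat) : R :=
  t^-1 * ((n == 0%N)%:R - poisson_weight t n) - ((n == 0%N)%:R - (n == 1%N)%:R).

(** The three contributions, from the indices 0, 1 and the rest, add up to exactly
    2 (1 - e^{-t}). *)
Lemma nsum_generator_error t : 0 < t ->
  (nsum (fun n => `|generator_error t n|%R) <= (t * 2)%:E)%E.
Proof.
move=> t0; have p0 n := poisson_weight_ge0 n (ltW t0).
have e1 : 1 - t <= expR (- t) by exact: expR_ge1Dx.
have e2 : expR (- t) <= 1 by rewrite expR_le1 oppr_le0 ltW.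
rewrite nsum_recl; last by move=> n; exact: normr_ge0.
rewrite nsum_recl /comp /=; last by move=> n; exact: normr_ge0.
have -> : nsum (fun n => `|generator_error t n.+2|) =
   (t^-1 * (1 - expR (- t) - t * expR (- t)))%:E.
  rewrite EFinM -nsum_poisson2 ?(ltW t0)// -nsumZl ?invr_ge0 ?(ltW t0)//.
  apply: eq_nsum => n; rewrite /generator_error /= subr0 sub0r subr0 normrM normrN.
  by rewrite !ger0_norm// invr_ge0 ltW.
rewrite -!EFinD lee_fin /generator_error /= poisson_weight0 poisson_weight1.
have -> : `|t^-1 * (1 - expR (- t)) - (1 - 0)| = 1 - t^-1 * (1 - expR (- t)).
  rewrite subr0 distrC ger0_norm// subr_ge0 ler_pdivrMl//; lra.
have -> : `|t^-1 * (0 - t * expR (- t)) - (0 - 1)| = 1 - expR (- t).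
  rewrite (_ : _ - _ = 1 - expR (- t)); last by field; lra.
  by rewrite ger0_norm// subr_ge0.
rewrite [leLHS](_ : _ = 2 * (1 - expR (- t))); last by field; lra.
lra.
Qed.

Lemma nsum_poisson_sub t : 0 <= t ->
  (nsum (fun n => `|poisson_weight t n - (n == 0%N)%:R|%R) <= (t * 2)%:E)%E.
Proof.
move=> t0; have p0 n := poisson_weight_ge0 n t0.
have e1 : 1 - t <= expR (- t) by exact: expR_ge1Dx.
have e2 : expR (- t) <= 1 by rewrite expR_le1 oppr_le0.
rewrite nsum_recl /comp /=; last by move=> n; exact: normr_ge0.
have -> : nsum (fun n => `|poisson_weight t n.+1 - 0|) = (1 - expR (- t))%:E.
  by rewrite -nsum_poisson1//; apply: eq_nsum => n; rewrite subr0 ger0_norm.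
rewrite -EFinD lee_fin poisson_weight0 distrC ger0_norm ?subr_ge0//; lra.
Qed.

End Poisson.

Section Semigroup.
Variables (R : realType) (X : countType) (G : graph R X) (m : X -> R).
Hypothesis m_gt0 : forall x, 0 < m x.
Hypothesis m_deg : forall x, m x = degree G x.
Implicit Types (f g : X -> R[i]) (C : R) (p : \bar R).

Local Notation mean := (averaging G m).
Local Notation Phi := (power_series G m).

Definition laplacian f : X -> R[i] := fun x => f x - mean f x.

(** The semigroup e^{-tL} = e^{-t} e^{tP} expanded in powers of P. *)
Definition heat (t : R) f := Phi (fun n => (poisson_weight t n)%:C) f.

Lemma nsum_normc_real (T : choiceType) (u : T -> R) :
  @nsum R T (fun n => normc (u n)%:C) = nsum (fun n => `|u n|).
Proof. by apply: eq_nsum => n; rewrite normc_real. Qed.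

Lemma heat_weights t : 0 <= t ->
  @nsum R nat (fun n => normc (poisson_weight t n)%:C) = 1%E.
Proof.
move=> t0; rewrite nsum_normc_real -(nsum_poisson t0).
by apply: eq_nsum => n; rewrite ger0_norm// poisson_weight_ge0.
Qed.

Lemma heat_csummable t : 0 <= t -> @csummable R _ (fun n => (poisson_weight t n)%:C).
Proof. by move=> t0; rewrite /csummable heat_weights ?ltry. Qed.

Lemma heat_bound p t f C : (1 <= p)%E -> 0 <= t -> 0 <= C ->
  (lnorm m p f <= C%:E)%E -> (lnorm m p (heat t f) <= C%:E)%E.
Proof.
move=> p1 t0 C0 fC; have := power_series_bound m_gt0 m_deg p1 ltr01 C0 _ fC.
by move=> /(_ (fun n => (poisson_weight t n)%:C))[|_]; rewrite ?heat_weights ?mul1r.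
Qed.

Lemma heat_lp p t f : (1 <= p)%E -> 0 <= t -> lp m p f -> lp m p (heat t f).
Proof. by move=> p1 t0; apply: power_series_lp => //; exact: heat_csummable. Qed.

Lemma heat_lin p t c f g : (1 <= p)%E -> 0 <= t -> lp m p f -> lp m p g ->
  heat t (fun x => c * f x + g x) = (fun x => c * heat t f x + heat t g x).
Proof.
move=> p1 t0 fp gp; apply: (power_series_lin m_gt0 m_deg _ p1) => //.
exact: heat_csummable.
Qed.

Lemma heatD p s t f : (1 <= p)%E -> 0 <= s -> 0 <= t -> lp m p f ->
  heat (s + t) f = heat s (heat t f).
Proof.
move=> p1 s0 t0 fp; rewrite /heat.
rewrite (power_series_comp m_gt0 m_deg p1 _ _ fp); try exact: heat_csummable.
apply: (congr1 (fun a => Phi a f)).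
apply/funext => j.
rewrite -poisson_conv.
rewrite (rmorph_sum (real_complex R)).
by apply: eq_bigr => k _; rewrite rmorphM.
Qed.

Lemma power_series_delta j f : Phi (fun n => (n == j)%:R) f = iter j mean f.
Proof.
apply/funext => x; rewrite /power_series (@csum_delta _ _ _ j) ?eqxx ?mul1r//.
by move=> n /negbTE ->; rewrite mul0r.
Qed.

Lemma delta_csummable j : csummable (fun n : nat => (n == j)%:R : R[i]).
Proof. by apply: (@csummable_delta _ _ _ j) => n /negbTE ->. Qed.

Lemma heat0 f : heat 0 f = f.
Proof.
rewrite -[RHS]/(iter 0 mean f) -power_series_delta; apply: (congr1 (fun a => Phi a f)); apply/funext => n.
by rewrite poisson_weight_at0 rmorph_nat.
Qed.

Lemma laplacianE f : laplacian f = Phi (fun n => (n == 0%N)%:R - (n == 1%N)%:R) f.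
Proof.
apply/funext => x; rewrite /power_series.
have s j : csummable (fun n : nat => (n == j)%:R * iter n mean f x).
  by apply: (@csummable_delta _ _ _ j) => n /negbTE ->; rewrite mul0r.
rewrite (@eq_csum _ _ _ (fun n => (n == 0%N)%:R * iter n mean f x - (n == 1%N)%:R * iter n mean f x)).
  rewrite csumB//.
  have e j : csum (fun n : nat => (n == j)%:R * iter n mean f x) = iter j mean f x.
    by have := power_series_delta j f => /(congr1 (fun h => h x)).
  by rewrite !e.
by move=> n; rewrite mulrBl.
Qed.

Lemma heat_error p t f : (1 <= p)%E -> 0 < t -> lp m p f ->
  (t^-1)%:C \*o (f - heat t f) - laplacian f =
  Phi (fun n => (generator_error t n)%:C) f.
Proof.
move=> p1 t0 fp.
have hs := heat_csummable (ltW t0).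
have ds := delta_csummable.
pose a n : R[i] := (n == 0%N)%:R + - (poisson_weight t n)%:C.
have as_ : csummable a by apply: csummableD => //; exact: csummableN.
pose b n : R[i] := - ((n == 0%N)%:R - (n == 1%N)%:R).
have bs : csummable b.
  by apply: csummableN; apply: csummableD => //; apply: csummableN.
transitivity (Phi (fun n => (t^-1)%:C * a n + b n) f); last first.
  apply: (congr1 (fun a => Phi a f)); apply/funext => n; rewrite /a /b /generator_error.
  by rewrite !(rmorphB, rmorphM, rmorph_nat)/=.
apply/funext => x; rewrite (power_series_lincoef m_gt0 m_deg _ _ p1)//.
have -> : Phi a f x = f x - heat t f x.
  transitivity (Phi (fun n => (-1) * (poisson_weight t n)%:C + (n == 0%N)%:R) f x).
    by apply: (congr1 (fun a => Phi a f x)); apply/funext => n; rewrite /a mulN1r addrC.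
  by rewrite (power_series_lincoef m_gt0 m_deg _ _ p1)// power_series_delta mulN1r addrC.
have -> : Phi b f x = - laplacian f x.
  rewrite laplacianE /power_series -csumN; apply: eq_csum => n; by rewrite mulNr.
by [].
Qed.

Lemma heat_error_bound p t f C : (1 <= p)%E -> 0 < t -> 0 <= C ->
  (lnorm m p f <= C%:E)%E ->
  (lnorm m p ((t^-1)%:C \*o (f - heat t f) - laplacian f)%R <= (t * 2 * C)%:E)%E.
Proof.
move=> p1 t0 C0 fC; rewrite (heat_error p1)//; last exact: bound_lp fC.
have t2 : 0 < t * 2 by rewrite mulr_gt0.
have := power_series_bound m_gt0 m_deg p1 t2 C0 _ fC.
move=> /(_ (fun n => (generator_error t n)%:C))[|_]//.
by rewrite nsum_normc_real nsum_generator_error.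
Qed.

Lemma heat_sub_bound p t f C : (1 <= p)%E -> 0 < t -> 0 <= C ->
  (lnorm m p f <= C%:E)%E ->
  (lnorm m p (heat t f - f)%R <= (t * 2 * C)%:E)%E.
Proof.
move=> p1 t0 C0 fC; have fp := bound_lp fC.
have -> : heat t f - f = Phi (fun n => (poisson_weight t n - (n == 0%N)%:R)%:C) f.
  apply/funext => x.
  transitivity (Phi (fun n => (-1) * (n == 0%N)%:R + (poisson_weight t n)%:C) f x).
    rewrite (power_series_lincoef m_gt0 m_deg _ _ p1)// ?power_series_delta ?mulN1r 1?addrC//.
      exact: delta_csummable.
    exact: heat_csummable (ltW t0).
  apply: (congr1 (fun a => Phi a f x)); apply/funext => n.
  by rewrite rmorphB rmorph_nat mulN1r addrC.
have t2 : 0 < t * 2 by rewrite mulr_gt0.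
have := power_series_bound m_gt0 m_deg p1 t2 C0 _ fC.
move=> /(_ (fun n => (poisson_weight t n - (n == 0%N)%:R)%:C))[|_]//.
by rewrite nsum_normc_real nsum_poisson_sub// ltW.
Qed.

Lemma laplacian_csummable :
  csummable (fun n : nat => (n == 0%N)%:R - (n == 1%N)%:R : R[i]).
Proof.
by apply: csummableD; [|apply: csummableN]; exact: delta_csummable.
Qed.

Lemma laplacian_lp p f : (1 <= p)%E -> lp m p f -> lp m p (laplacian f).
Proof.
move=> p1 fp; rewrite laplacianE; apply: power_series_lp => //; exact: laplacian_csummable.
Qed.

(** Uniqueness of limits in l^p, read pointwise. *)
Lemma eq_of_lnorm_small p f g : (1 <= p)%E ->
  (forall e, 0 < e -> exists2 h, (lnorm m p (h - f)%R <= e%:E)%E &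
                                 (lnorm m p (h - g)%R <= e%:E)%E) ->
  f = g.
Proof.
move=> p1 h; apply/funext => x; apply/eqP; rewrite -subr_eq0.
have [K K0 Kx] := lnorm_point m_gt0 x p1.
apply/eqP/eq0_normc/eqP; rewrite eq_le normc_ge0 andbT.
apply/ler_addgt0Pr => e e0; rewrite add0r.
have [|u uf ug] := h (e / (2 * K + 1)); first by rewrite divr_gt0//; lra.
have d0 : 0 <= e / (2 * K + 1) by rewrite divr_ge0//; lra.
have := Kx _ _ d0 uf; have := Kx _ _ d0 ug; rewrite !fctE /= => h1 h2.
have -> : f x - g x = (u x - g x) - (u x - f x) by ring.
apply: le_trans (normcB_le _ _) _.
apply: (@le_trans _ _ ((2 * K) * (e / (2 * K + 1)))); first lra.
rewrite mulrCA ler_piMr ?(ltW e0)// ler_pdivrMr; lra.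
Qed.

Lemma heat_generator p f g : (1 <= p)%E ->
  generator m p heat f g <-> lp m p f /\ g = laplacian f.
Proof.
move=> p1; split.
  move=> [fp gp cv]; split => //.
  have [C C0 fC] := lp_bound fp.
  apply: (eq_of_lnorm_small p1) => e e0.
  move/right_cvg0P: cv => /(_ (fun=> lnorm_ge0 _ _ _))/(_ e e0)[d d0 hd].
  pose t := Num.min (d / 2) (e / (2 * C + 1)).
  have e1 : 0 < e / (2 * C + 1) by rewrite divr_gt0//; lra.
  have t0 : 0 < t by rewrite lt_min e1 divr_gt0.
  have td : t < d by rewrite gt_min; apply/orP; left; lra.
  have tC : t <= e / (2 * C + 1) by rewrite ge_min lexx orbT.
  exists ((t^-1)%:C \*o (f - heat t f)); first exact: hd.
  apply: le_trans (heat_error_bound p1 t0 C0 _) _; first by rewrite fC.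
  rewrite lee_fin; move: tC; rewrite ler_pdivlMr; last by lra.
  by move=> tC; rewrite (le_trans _ tC)// -mulrA ler_wpM2l ?(ltW t0)//; lra.
move=> [fp ->]; split => //; first exact: laplacian_lp.
have [C C0 fC] := lp_bound fp.
apply: (@right_cvg0_linear _ _ (2 * C)); first by rewrite mulr_ge0.
  by move=> t; exact: lnorm_ge0.
by move=> t t0; rewrite mulrA; apply: heat_error_bound => //; rewrite fC.
Qed.

Lemma heat_contraction p : (1 <= p)%E -> contraction_semigroup m p heat.
Proof.
move=> p1; split.
- move=> t f t0 fp; have [C C0 fC] := lp_bound fp.
  by rewrite fC; apply: heat_bound => //; rewrite fC.
- by move=> t a f g; exact: heat_lin.
- by move=> f _; exact: heat0.
- by move=> s t f s0 t0 fp; exact: (heatD p1).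
Qed.

Lemma heat_continuous p : (1 <= p)%E -> strongly_continuous m p heat.
Proof.
move=> p1 f fp; have [C C0 fC] := lp_bound fp.
apply: (@right_cvg0_linear _ _ (2 * C)); first by rewrite mulr_ge0.
  by move=> t; exact: lnorm_ge0.
by move=> t t0; rewrite mulrA; apply: heat_sub_bound => //; rewrite fC.
Qed.

End Semigroup.

(** * The Green formula and the energy form *)

Section EnergyForm.
Variables (R : realType) (X : countType) (G : graph R X) (m : X -> R).
Hypothesis m_gt0 : forall x, 0 < m x.
Hypothesis m_deg : forall x, m x = degree G x.
Hypothesis c_eq0 : forall x, gc G x = 0.
Implicit Types (f g u : X -> R[i]) (C : R) (p : \bar R).

Local Notation mean := (averaging G m).
Local Notation L := (laplacian G m).

Let b_ge0 x y : 0 <= gb G x y := gb_ge0 G x y.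

(** Expanding b(x,y) (f(x) - f(y)) u(x) gives this term minus the cross term.  Green's
    formula and the symmetry of L only exchange x and y in the two double sums. *)
Definition diagonal_term f u x y : R[i] := (gb G x y)%:C * f x * u x.
Definition cross_term f u x y : R[i] := (gb G x y)%:C * f y * u x.

Definition edge_summable (E : X -> X -> R[i]) : Prop :=
  (\esum_(x in [set: X]) nsum (fun y => normc (E x y)) < +oo)%E.

Lemma csum_edges x : csum (fun y => (gb G x y)%:C) = (m x)%:C.
Proof. by rewrite csum_nonneg// (nsum_edges m_deg). Qed.

(** Summing over y first, the diagonal terms produce m(x) f(x) u(x) because m is the
    degree, and the cross terms produce m(x) P f(x) u(x). *)
Lemma pairing_laplacian p f u : (1 <= p)%E -> lp m p f ->
  edge_summable (diagonal_term f u) -> edge_summable (cross_term f u) ->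
  dual_pairing m (L f) u =
  csum (fun x => csum (diagonal_term f u x)) - csum (fun x => csum (cross_term f u x)).
Proof.
move=> p1 /lp_bound[C C0 fC] ds cs.
have [dr dt] := csummable_iter ds; have [cr ct] := csummable_iter cs.
rewrite -csumB//; apply: eq_csum => x.
have sb : csummable (fun y => (gb G x y)%:C).
  rewrite /csummable (@eq_nsum _ _ _ (gb G x)) ?(nsum_edges m_deg) ?ltry//.
  by move=> y; rewrite normc_real ger0_norm.
have [|sf _] := @mean_bound _ _ _ _ m_gt0 m_deg p f C p1 C0; first by rewrite fC.
have mC : (m x)%:C != 0 :> R[i] by rewrite fmorph_eq0 gt_eqF.
have -> : csum (diagonal_term f u x) = (f x * u x) * (m x)%:C.
  rewrite -csum_edges -csumZ//; apply: eq_csum => y.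
  by rewrite /diagonal_term; ring.
have -> : csum (cross_term f u x) = ((m x)%:C * u x) * mean f x.
  rewrite -csumZ; last exact: sf.
  apply: eq_csum => y; rewrite /cross_term rmorphM fmorphV; field.
  exact: mC.
by rewrite /laplacian; ring.
Qed.

Lemma diagonal_termC f u : diagonal_term f u = diagonal_term u f.
Proof. by apply/funext => x; apply/funext => y; rewrite /diagonal_term mulrAC. Qed.

Lemma cross_termC f u x y : cross_term f u x y = cross_term u f y x.
Proof. by rewrite /cross_term mulrAC gb_sym. Qed.

Lemma cross_summableC f u : edge_summable (cross_term f u) ->
  edge_summable (cross_term u f).
Proof.
rewrite /edge_summable nsum_fubini; last by move=> x y; exact: normc_ge0.
congr (_ < _)%E; apply: eq_esum => x _; apply: eq_nsum => y.
by rewrite cross_termC.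
Qed.

Lemma csum_cross_termC f u : edge_summable (cross_term f u) ->
  csum (fun x => csum (cross_term f u x)) = csum (fun x => csum (cross_term u f x)).
Proof.
move=> cs; rewrite csum_fubini//; apply: eq_csum => x; apply: eq_csum => y.
by rewrite cross_termC.
Qed.

(** Exchanging x and y turns the cross terms of (f, u) into those of (u, f), and the
    diagonal terms are symmetric in f and u. *)
Lemma laplacian_symmetric p q f u : (1 <= p)%E -> (1 <= q)%E ->
  lp m p f -> lp m q u ->
  edge_summable (diagonal_term f u) -> edge_summable (cross_term f u) ->
  dual_pairing m (L f) u = dual_pairing m f (L u).
Proof.
move=> p1 q1 fp uq ds cs; rewrite (pairing_laplacian p1)//.
rewrite (csum_cross_termC cs) diagonal_termC -(pairing_laplacian q1)//.
- by apply: eq_csum => x; rewrite [f x * _]mulrC.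
- by rewrite diagonal_termC.
- exact: cross_summableC.
Qed.

(** The integrand of Q is E(x,y) + E(y,x) with E the diagonal minus the cross term,
    so the factor 1/2 in Q cancels against the exchange of x and y. *)
Lemma green_formula p f g : (1 <= p)%E -> lp m p f ->
  edge_summable (diagonal_term f (fun x => conjc (g x))) ->
  edge_summable (cross_term f (fun x => conjc (g x))) ->
  Q G f g = inner2 m (L f) g.
Proof.
move=> p1 fp; set u := fun x => conjc (g x).
move=> ds cs; rewrite /Q [X in _ + X]csum0; last by move=> x; rewrite c_eq0 !mul0r.
rewrite addr0 -[RHS]/(dual_pairing m (L f) u) (pairing_laplacian p1)//.
pose E x y := diagonal_term f u x y - cross_term f u x y.
have Es : edge_summable E.
  apply: (@le_lt_trans _ _ (\esum_(x in [set: X]) nsum (fun y => normc (diagonal_term f u x y)) +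
       \esum_(x in [set: X]) nsum (fun y => normc (cross_term f u x y)))%E); last first.
    exact: lte_add_pinfty.
  rewrite -esumD; try by move=> x _; apply: nsum_ge0 => y; exact: normc_ge0.
  apply: le_esum => x _; rewrite -nsumD; try by move=> y; exact: normc_ge0.
  by apply: le_nsum => y; exact: normcB_le.
have Ep : csummable (fun xy : X * X => E xy.1 xy.2).
  by rewrite /csummable (nsum_pair (u := fun x y => normc (E x y)))// => x y; exact: normc_ge0.
have sw : injective (fun xy : X * X => (xy.2, xy.1)) by move=> [? ?] [? ?] [-> ->].
have swN : forall (w : X * X), ~ (forall v, (v.2, v.1) != w).
  by move=> [x y] /(_ (y, x)); rewrite eqxx.
have Ep' : csummable (fun xy : X * X => E xy.2 xy.1).
  move: Ep; rewrite /csummable (nsum_inj sw)//.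
  by move=> w /swN.
have [dr dt] := csummable_iter ds; have [cr ct] := csummable_iter cs.
rewrite (@eq_csum _ _ _ (fun xy => E xy.1 xy.2 + E xy.2 xy.1)); last first.
  move=> [x y]; rewrite -[LHS]/((gb G x y)%:C * (f x - f y) * conjc (g x - g y)).
  rewrite -[RHS]/(E x y + E y x) /E /diagonal_term /cross_term (gb_sym G y x).
  have -> : conjc (g x - g y) = conjc (g x) - conjc (g y) by exact: rmorphB.
  by rewrite /u; ring.
rewrite csumD//.
have -> : csum (fun xy : X * X => E xy.2 xy.1) = csum (fun xy : X * X => E xy.1 xy.2).
  by rewrite [RHS](csum_inj sw)// => w /swN.
rewrite csum_pair//.
have -> : csum (fun x => csum (E x)) =
    csum (fun x => csum (diagonal_term f u x)) - csum (fun x => csum (cross_term f u x)).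
  by rewrite -csumB//; apply: eq_csum => x; rewrite -csumB.
by rewrite (fmorphV (real_complex R)) (rmorph_nat (real_complex R)); field.
Qed.

Definition sqnorm f : \bar R := nsum (fun x => m x * normc (f x) ^+ 2).

Lemma p2_ge1 : (1 <= 2%:E :> \bar R)%E.
Proof. by rewrite lee_fin; lra. Qed.

Lemma lnorm2P f C : 0 <= C -> (lnorm m 2%:E f <= C%:E)%E <-> (sqnorm f <= (C ^+ 2)%:E)%E.
Proof.
move=> C0; rewrite (lnorm_finP m_gt0)//; last by lra.
rewrite (powR_mulrn 2)// /sqnorm.
rewrite (@eq_nsum _ _ (fun x => normc (f x) `^ 2 * m x) (fun x => m x * normc (f x) ^+ 2))// => x.
by rewrite (powR_mulrn 2) ?normc_ge0// mulrC.
Qed.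

Lemma sqnorm_lty f : lp m 2%:E f -> (sqnorm f < +oo)%E.
Proof.
move=> /lp_bound[C C0 fC]; apply: (@le_lt_trans _ _ (C ^+ 2)%:E); last exact: ltry.
by apply/lnorm2P => //; rewrite fC.
Qed.

Lemma nsum_edge_out (v : X -> R) : (forall x, 0 <= v x) ->
  (\esum_(x in [set: X]) nsum (fun y => (gb G x y * v x)%R) = nsum (fun x => (m x * v x)%R))%E.
Proof.
move=> v0; apply: eq_esum => x _.
rewrite (@eq_nsum _ _ _ (fun y => v x * gb G x y)); last by move=> y; rewrite mulrC.
by rewrite nsumZl// (nsum_edges m_deg) mulrC.
Qed.

(** Edge sums of v(x) + w(y) are integrals of v + w against m; all the summability
    over edges is reduced to this. *)
Lemma esum_edges_le (v w : X -> R) (E : X -> X -> R) : (forall x, 0 <= v x) ->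
  (forall x, 0 <= w x) -> (forall x y, E x y <= gb G x y * v x + gb G x y * w y) ->
  (\esum_(x in [set: X]) nsum (E x) <=
   nsum (fun x => (m x * v x)%R) + nsum (fun x => (m x * w x)%R))%E.
Proof.
move=> v0 w0 Evw.
rewrite -nsum_edge_out// -(nsum_edge_weight m_deg)// -esumD; last 2 first.
- by move=> x _; apply: nsum_ge0 => y; rewrite mulr_ge0.
- by move=> x _; apply: nsum_ge0 => y; rewrite mulr_ge0.
apply: le_esum => x _; rewrite -nsumD; last 2 first.
- by move=> y; rewrite mulr_ge0.
- by move=> y; rewrite mulr_ge0.
exact: le_nsum.
Qed.

Lemma normc_edge x y a b : normc ((gb G x y)%:C * a * b) = gb G x y * (normc a * normc b).
Proof. by rewrite !normcM normc_real ger0_norm// mulrA. Qed.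

Lemma l2_edge_summable f u : lp m 2%:E f -> lp m 2%:E u ->
  edge_summable (diagonal_term f u) /\ edge_summable (cross_term f u).
Proof.
move=> fs us; have ff := sqnorm_lty fs; have uf := sqnorm_lty us.
have amgm (a b : R) : 0 <= a -> 0 <= b -> a * b <= a ^+ 2 + b ^+ 2.
  by move=> a0 b0; have := sqr_ge0 (a - b); nra.
have h a b : 0 <= normc a ^+ 2 + normc b ^+ 2 :> R by rewrite addr_ge0 ?sqr_ge0.
split.
  apply: (@le_lt_trans _ _ (nsum (fun x => (m x * (normc (f x) ^+ 2 + normc (u x) ^+ 2))%R) +
      nsum (fun x => (m x * 0)%R))%E).
    apply: esum_edges_le => // x y.
    rewrite mulr0 addr0 normc_edge ler_wpM2l// amgm ?normc_ge0//.
  rewrite [X in (_ + X)%E]nsum0 ?adde0; last by move=> x; rewrite mulr0.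
  rewrite (@eq_nsum _ _ _ (fun x => m x * normc (f x) ^+ 2 + m x * normc (u x) ^+ 2)); last first.
    by move=> x; rewrite mulrDr.
  rewrite nsumD; last 2 first.
  - by move=> x; rewrite mulr_ge0 ?(ltW (m_gt0 x))// sqr_ge0.
  - by move=> x; rewrite mulr_ge0 ?(ltW (m_gt0 x))// sqr_ge0.
  exact: lte_add_pinfty.
apply: (@le_lt_trans _ _ (sqnorm u + sqnorm f)%E); last exact: lte_add_pinfty.
apply: esum_edges_le; try by move=> x; exact: sqr_ge0.
move=> x y; rewrite normc_edge -mulrDr ler_wpM2l// addrC amgm ?normc_ge0//.
Qed.

Lemma energy_ge0 f : (0 <= energy G f)%E.
Proof.
rewrite /energy adde_ge0// ?mule_ge0 ?lee_fin ?invr_ge0//.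
  by apply: esum_ge0 => xy _; rewrite lee_fin mulr_ge0// sqr_ge0.
by apply: esum_ge0 => xy _; rewrite lee_fin c_eq0 mul0r.
Qed.

(** The form is bounded by |f(x) - f(y)|^2 <= 2 |f(x)|^2 + 2 |f(y)|^2, which is why
    its domain is all of l^2. *)
Lemma energy_le f : (energy G f <= 2%:E * sqnorm f)%E.
Proof.
rewrite /energy [X in (_ + X)%E]esum1; last by move=> x _; rewrite c_eq0 mul0r.
rewrite adde0.
rewrite -[X in (_ * X)%E]/(nsum (fun xy : X * X => gb G xy.1 xy.2 * normc (f xy.1 - f xy.2) ^+ 2)).
rewrite (nsum_pair (u := fun x y => gb G x y * normc (f x - f y) ^+ 2)); last first.
  by move=> x y; rewrite mulr_ge0// sqr_ge0.
have s0 x : 0 <= 2 * normc (f x) ^+ 2 by rewrite mulr_ge0// sqr_ge0.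
have := @esum_edges_le (fun x => 2 * normc (f x) ^+ 2) (fun x => 2 * normc (f x) ^+ 2)
  (fun x y => gb G x y * normc (f x - f y) ^+ 2) s0 s0 _.
have -> : nsum (fun x => m x * (2 * normc (f x) ^+ 2)) = (2%:E * sqnorm f)%E.
  rewrite -nsumZl//; last by move=> x; rewrite mulr_ge0 ?(ltW (m_gt0 x))// sqr_ge0.
  by apply: eq_nsum => x; rewrite mulrCA.
move=> h; have {}h : (\esum_(x in [set: X]) nsum (fun y => (gb G x y * normc (f x - f y) ^+ 2)%R)
    <= 2%:E * (2%:E * sqnorm f))%E.
  apply: le_trans (h _) _.
    move=> x y; rewrite -mulrDr ler_wpM2l//.
    apply: (@le_trans _ _ ((normc (f x) + normc (f y)) ^+ 2)).
      by rewrite ler_sqr ?nnegrE ?addr_ge0 ?normc_ge0// normcB_le.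
    by have := sqr_ge0 (normc (f x) - normc (f y)); nra.
  by rewrite [leRHS]mule_natl mule2n.
apply: le_trans (lee_wpmul2l _ h) _; first by rewrite lee_fin invr_ge0.
by rewrite muleA -EFinM mulVf// mul1e.
Qed.

Lemma Qnorm_le f C : 0 <= C -> (lnorm m 2%:E f <= C%:E)%E ->
  (Qnorm G m f <= (2 * C)%:E)%E.
Proof.
move=> C0 fC; have n0 := lnorm_ge0 m 2%:E f.
have sC := (lnorm2P f C0).1 fC.
have s0 : (0 <= energy G f + lnorm m 2%:E f ^+ 2)%E.
  by apply: adde_ge0; [exact: energy_ge0|rewrite expe2 mule_ge0].
have le3 : (energy G f + lnorm m 2%:E f ^+ 2 <= ((2 * C) ^+ 2)%:E)%E.
  rewrite (_ : ((2 * C) ^+ 2)%:E = (3 * C ^+ 2)%:E + (C ^+ 2)%:E)%E; last first.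
    by rewrite -EFinD; congr EFin; ring.
  apply: leeD; last by rewrite expe2 expr2 EFinM; exact: lee_pmul.
  apply: le_trans (energy_le f) _.
  apply: (@le_trans _ _ (2%:E * (C ^+ 2)%:E)%E); first exact: lee_wpmul2l.
  by rewrite -EFinM lee_fin; have := sqr_ge0 C; nra.
rewrite /Qnorm (_ : (2 * C)%:E = ((2 * C) ^+ 2)%:E `^ 2^-1)%E; last first.
  by rewrite poweR_EFin powR12_sqrt ?sqr_ge0// sqrtr_sqr ger0_norm ?mulr_ge0.
apply: gt0_ler_poweR => //.
  by rewrite in_itv /= s0 leey.
by rewrite in_itv /= leey andbT lee_fin sqr_ge0.
Qed.

End EnergyForm.

(** * Existence and uniqueness of the heat semigroup *)

Section HeatSemigroup.
Variables (R : realType) (X : countType) (G : graph R X) (m : X -> R).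
Hypothesis m_gt0 : forall x, 0 < m x.
Hypothesis m_deg : forall x, m x = degree G x.
Hypothesis c_eq0 : forall x, gc G x = 0.
Implicit Types (f g u : X -> R[i]) (C : R) (p : \bar R).

Local Notation L := (laplacian G m).
Local Notation S := (heat G m).

(** Finitely supported functions are dense in l^2 and the form norm is equivalent to
    the norm of l^2. *)
Lemma DQ_l2 f : DQ G m f <-> lp m 2%:E f.
Proof.
have p2 := @p2_ge1 R; split.
  move=> /(_ 1 ltr01)[phi phic]; set h := f - phi => h1.
  have hp : lp m 2%:E h.
    have n2 : (2^-1 : R) != 0 by rewrite invr_eq0.
    have := lty_poweRy n2 (lt_trans h1 (ltry 1)).
    rewrite /lp /mkset ltNge => hfin; rewrite ltNge leye_eq.
    apply: contra hfin => /eqP ->.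
    rewrite expe2 mulyy addey ?leey// gt_eqF// (lt_le_trans (ltNyr 0))//.
    exact: energy_ge0.
  have := lp_lin m_gt0 1 p2 hp (Cc_lp m_gt0 p2 phic).
  by congr (lp _ _ _); apply/funext => x; rewrite /h !fctE /= mul1r subrK.
move=> fp e e0; have e4 : 0 < e / 4 by rewrite divr_gt0.
have [|phi phic fphi] := Cc_dense m_gt0 _ fp e4; first by lra.
exists phi => //; apply: le_lt_trans (Qnorm_le m_gt0 m_deg c_eq0 (ltW e4) fphi) _.
by rewrite lte_fin; lra.
Qed.

Lemma Q_laplacian f h : lp m 2%:E f -> lp m 2%:E h -> Q G f h = inner2 m (L f) h.
Proof.
move=> fp hp; have p2 := @p2_ge1 R.
have hp' : lp m 2%:E (fun x => conjc (h x)).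
  apply: le_lt_trans hp; rewrite (@eq_lnorm _ _ m 2%:E _ h)// => x.
  exact: normc_conj.
have [ds cs] := l2_edge_summable m_gt0 m_deg fp hp'.
exact: (green_formula m_gt0 m_deg c_eq0 p2).
Qed.

(** Green's formula gives Q f h = (L f, h); conversely testing against the unit mass
    at x determines the value at x. *)
Lemma L2_laplacian f g : L2 G m f g <-> lp m 2%:E f /\ g = L f.
Proof.
have p2 := @p2_ge1 R; split.
  move=> [/DQ_l2 fp gp fg]; split => //; apply/funext => x.
  pose d y : R[i] := (y == x)%:R.
  have dp : lp m 2%:E d by apply: Cc_lp => //; exact: Cc_delta.
  have := fg d ((DQ_l2 d).2 dp); rewrite (Q_laplacian fp dp).
  have mx : (m x)%:C != 0 :> R[i] by rewrite fmorph_eq0 gt_eqF.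
  have e u : inner2 m u d = u x * (m x)%:C.
    rewrite /inner2 (@csum_delta _ _ _ x); first by rewrite /d eqxx conjC1 mulr1.
    by move=> y /negbTE yx; rewrite /d yx conjC0 mulr0 mul0r.
  by rewrite !e => /(mulIf mx).
move=> [fp ->]; split; first exact/DQ_l2.
  exact: laplacian_lp.
by move=> h /DQ_l2 hp; exact: Q_laplacian.
Qed.

Lemma heat_is_heat_semigroup : heat_semigroup G m S.
Proof.
split=> [f g|p p1].
  rewrite L2_laplacian; exact: (heat_generator m_gt0 m_deg f g (@p2_ge1 R)).
split; first exact: heat_contraction.
by move=> _; exact: heat_continuous.
Qed.

Section Uniqueness.
Variable T : R -> (X -> R[i]) -> (X -> R[i]).
Hypothesis Theat : heat_semigroup G m T.

Let p2 := @p2_ge1 R.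

Lemma semigroup_lp p t f : (1 <= p)%E -> 0 <= t -> lp m p f -> lp m p (T t f).
Proof.
move=> p1 t0 fp; have [[Tc _ _ _] _] := Theat.2 p p1.
by apply: le_lt_trans (Tc _ _ t0 fp) fp.
Qed.

Lemma semigroup_bound p t f C : (1 <= p)%E -> 0 <= t -> (lnorm m p f <= C%:E)%E ->
  (lnorm m p (T t f) <= C%:E)%E.
Proof.
move=> p1 t0 fC; have [[Tc _ _ _] _] := Theat.2 p p1.
exact: le_trans (Tc _ _ t0 (bound_lp fC)) fC.
Qed.

Lemma semigroup_lin p t (c : R[i]) f g : (1 <= p)%E -> 0 <= t -> lp m p f -> lp m p g ->
  T t (fun x => c * f x + g x) = (fun x => c * T t f x + T t g x).
Proof.
move=> p1 t0 fp gp; have [[_ Tl _ _] _] := Theat.2 p p1.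
exact: Tl.
Qed.

Lemma semigroup_scale p t (c : R[i]) f : (1 <= p)%E -> 0 <= t -> lp m p f ->
  T t (fun x => c * f x) = (fun x => c * T t f x).
Proof.
move=> p1 t0 fp.
have T0 : T t (fun=> 0) = fun=> 0.
  have := semigroup_lin (-1) p1 t0 fp fp.
  rewrite (_ : (fun x => _ + _) = (fun=> 0)) => [->|]; apply/funext => x.
    by rewrite mulN1r addNr.
  by rewrite mulN1r addNr.
have := semigroup_lin c p1 t0 fp (lp0 m_gt0 p1); rewrite T0.
rewrite (_ : (fun x => _ * f x + _) = (fun x => c * f x)) => [->|]; apply/funext => x.
  by rewrite addr0.
by rewrite addr0.
Qed.

Definition quotient_error (U : R -> (X -> R[i]) -> (X -> R[i])) (t : R) f : X -> R[i] :=
  fun x => (t^-1)%:C * (f x - U t f x) - L f x.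

Lemma quotient_error_small f e : lp m 2%:E f -> 0 < e -> exists2 d, 0 < d &
  forall t, 0 < t -> t < d -> (lnorm m 2%:E (quotient_error T t f) <= e%:E)%E.
Proof.
move=> fp e0; have [_ _ cv] := (Theat.1 f (L f)).2 ((L2_laplacian f (L f)).2 (conj fp erefl)).
by move/right_cvg0P: cv => /(_ (fun=> lnorm_ge0 _ _ _))/(_ e e0).
Qed.

(** T_s commutes with T_t and is linear on l^2, so it can be applied inside the
    difference quotient. *)
Lemma semigroup_quotient s t f : 0 <= s -> 0 <= t -> lp m 2%:E f ->
  T s (fun x => (t^-1)%:C * (f x - T t f x) - L f x) =
  (fun x => (t^-1)%:C * (T s f x - T t (T s f) x) - T s (L f) x).
Proof.
move=> s0 t0 fp.
have [[_ _ _ Tsg] _] := Theat.2 _ p2.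
have fTp : lp m 2%:E (fun x => (-1) * T t f x + f x).
  by apply: lp_lin => //; exact: semigroup_lp.
have Lp' : lp m 2%:E (fun x => (-1) * L f x).
  have := lp_lin m_gt0 (-1) p2 (laplacian_lp m_gt0 m_deg p2 fp) (lp0 m_gt0 p2).
  by congr (lp _ _ _); apply/funext => x; rewrite addr0.
have -> : (fun x => (t^-1)%:C * (f x - T t f x) - L f x) =
    (fun x => (t^-1)%:C * ((-1) * T t f x + f x) + (-1) * L f x).
  by apply/funext => x; ring.
rewrite (semigroup_lin _ p2 s0 fTp Lp') (semigroup_lin _ p2 s0 (semigroup_lp p2 t0 fp) fp).
rewrite (semigroup_scale _ p2 s0); last exact: laplacian_lp.
have -> : T s (T t f) = T t (T s f) by rewrite -!Tsg// addrC.
by apply/funext => x; ring.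
Qed.

(** Both sides are limits of the difference quotient of T_s f: the left one through
    the continuity of T_s, the right one because every element of l^2 lies in the
    domain of the generator. *)
Lemma semigroup_laplacian s f : 0 <= s -> lp m 2%:E f -> T s (L f) = L (T s f).
Proof.
move=> s0 fp; apply: (eq_of_lnorm_small m_gt0 p2) => e e0.
have Tfp := semigroup_lp p2 s0 fp.
have [d1 d10 h1] := quotient_error_small fp e0.
have [d2 d20 h2] := quotient_error_small Tfp e0.
pose t := Num.min d1 d2 / 2.
have d0 : 0 < Num.min d1 d2 by rewrite lt_min d10.
have t0 : 0 < t by rewrite divr_gt0.
have td1 : t < d1.
  have : Num.min d1 d2 <= d1 by rewrite ge_min lexx.
  by rewrite /t; lra.
have td2 : t < d2.
  have : Num.min d1 d2 <= d2 by rewrite ge_min lexx orbT.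
  by rewrite /t; lra.
exists (fun x => (t^-1)%:C * (T s f x - T t (T s f) x)); last exact: (h2 t).
have := semigroup_bound p2 s0 (h1 t t0 td1).
by rewrite /quotient_error (semigroup_quotient s0 (ltW t0) fp).
Qed.

(** The error at T_s f is T_s applied to the error at f, so it is controlled
    uniformly in s.  This uniformity replaces a differentiation argument. *)
Lemma quotient_error_bound s t f C : 0 <= s -> 0 < t -> lp m 2%:E f ->
  (lnorm m 2%:E (quotient_error T t f) <= C%:E)%E ->
  (lnorm m 2%:E (quotient_error T t (T s f)) <= C%:E)%E.
Proof.
move=> s0 t0 fp /(semigroup_bound p2 s0).
by rewrite /quotient_error (semigroup_quotient s0 (ltW t0) fp) semigroup_laplacian.
Qed.

(** Telescope T_t f - S_t f along S_{(n-k)h} T_{kh} f with h = t/n.  Each of the n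
    steps costs h times the error of the difference quotients of T and S, which is
    small uniformly in k. *)
Lemma heat_unique_l2 t f : 0 <= t -> lp m 2%:E f -> T t f = S t f.
Proof.
move=> t0 fp; apply/funext => x; apply/eqP; rewrite -subr_eq0.
have [K K0 Kx] := lnorm_point m_gt0 x p2.
apply/eqP/eq0_normc/eqP; rewrite eq_le normc_ge0 andbT.
apply/ler_addgt0Pr => e e0; rewrite add0r.
have [C C0 fC] := lp_bound fp.
(* The n steps cost 2 K h D each, hence 2 K t D < e in total. *)
pose D := e / (2 * K * t + 1).
have Kt0 : 0 <= 2 * K * t by rewrite !mulr_ge0.
have D0 : 0 < D by rewrite divr_gt0//; lra.
have [d d0 hd] := quotient_error_small fp D0.
have [n [n0 nd nC]] : exists n : nat, [/\ (0 < n)%N, t / n%:R < d & t / n%:R * 2 * C <= D].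
  (* The two terms make h < d, and the error 2 h C of the Poisson semigroup at most D. *)
  pose N := Num.truncn (t / d + t * 2 * C / D) .
  have tN : t / d + t * 2 * C / D < (N.+1)%:R by exact: truncnS_gt.
  have a0 : 0 <= t / d by rewrite divr_ge0// ltW.
  have b0 : 0 <= t * 2 * C / D by rewrite divr_ge0 ?(ltW D0)// !mulr_ge0.
  exists N.+1; split => //.
    by rewrite ltr_pdivrMr// mulrC -ltr_pdivrMr//; lra.
  rewrite (_ : t / N.+1%:R * 2 * C = (t * 2 * C) / N.+1%:R); last by ring.
  by rewrite ler_pdivrMr// [D * _]mulrC -ler_pdivrMr//; lra.
pose h := t / n%:R.
have nR0 : 0 < n%:R :> R by rewrite ltr0n.
have h_ge0 : 0 <= h by rewrite divr_ge0// ltW.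
have tE : t = n%:R * h by rewrite /h mulrC divfK// gt_eqF.
have [t_eq0|tN0] := eqVneq t 0.
  have [[_ _ T0 _] _] := Theat.2 _ p2.
  by rewrite t_eq0 (T0 _ fp) heat0 subrr normc0 ltW.
have h0 : 0 < h by rewrite /h divr_gt0// lt_neqAle eq_sym tN0.
have [[_ _ T0 Tsg] _] := Theat.2 _ p2.
have hD0 : 0 <= h * (2 * D) := mulr_ge0 h_ge0 (mulr_ge0 (ler0n _ 2) (ltW D0)).
have step s : 0 <= s -> (lnorm m 2%:E (fun y => T h (T s f) y - S h (T s f) y)%R <=
    (h * (2 * D))%:E)%E.
  move=> s0; have Tfp := semigroup_lp p2 s0 fp.
  have e1 := quotient_error_bound s0 h0 fp (hd h h0 nd).
  have e2 : (lnorm m 2%:E (quotient_error S h (T s f)) <= D%:E)%E.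
    have fC' : (lnorm m 2%:E f <= C%:E)%E by rewrite fC.
    have := heat_error_bound m_gt0 m_deg p2 h0 C0 (semigroup_bound p2 s0 fC').
    by move=> /le_trans; apply; rewrite lee_fin.
  have := lnorm_lin m_gt0 (-1) p2 (ltW D0) e1 e2.
  rewrite normcN normc1 => e3.
  have D2 : 0 <= (1 + 1) * D by rewrite mulr_ge0// ltW.
  have := lnormZ m_gt0 (h%:C) p2 D2 e3.
  rewrite normc_real gtr0_norm//.
  apply: eq_lnorm_le => y; rewrite /quotient_error fmorphV; field.
  by rewrite fmorph_eq0 gt_eqF.
have tele k : (k <= n)%N ->
  normc (S ((n - k)%:R * h) (T (k%:R * h) f) x - S t f x) <= k%:R * (K * (h * (2 * D))).
  elim: k => [_|k ih kn].
    by rewrite !mul0r subn0 -tE (T0 _ fp) subrr normc0.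
  have kh0 : 0 <= k%:R * h by rewrite mulr_ge0.
  have nk0 : 0 <= (n - k.+1)%:R * h by rewrite mulr_ge0.
  have Tfp := semigroup_lp p2 kh0 fp.
  have -> : T (k.+1%:R * h) f = T h (T (k%:R * h) f).
    by rewrite -Tsg//; congr (T _ f); rewrite -natr1 mulrDl mul1r addrC.
  have eS : S ((n - k)%:R * h) (T (k%:R * h) f) = S ((n - k.+1)%:R * h) (S h (T (k%:R * h) f)).
    rewrite (_ : (n - k)%:R * h = (n - k.+1)%:R * h + h).
      by rewrite (heatD m_gt0 m_deg p2).
    by rewrite -[in LHS](subnSK kn) -natr1 mulrDl mul1r.
  have := ih (ltnW kn); rewrite eS => {}ih.
  set a := S _ _ x; set b := S ((n - k.+1)%:R * h) (S h _) x in ih *.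
  have ab : normc (a - b) <= K * (h * (2 * D)).
    apply: (@le_trans _ _ (normc (S ((n - k.+1)%:R * h) (fun y => (-1) * S h (T (k%:R * h) f) y + T h (T (k%:R * h) f) y) x))).
      have STfp := heat_lp m_gt0 m_deg p2 h_ge0 Tfp.
      have TTfp := semigroup_lp p2 h_ge0 Tfp.
      by rewrite (heat_lin m_gt0 m_deg (-1) p2 nk0 STfp TTfp) mulN1r addrC.
    apply: Kx => //; apply: heat_bound => //.
    apply: eq_lnorm_le (step _ kh0) => y.
    by rewrite mulN1r addrC.
  rewrite (_ : a - S t f x = (a - b) + (b - S t f x)); last by ring.
  apply: le_trans (le_normcD _ _) _; rewrite -natr1 mulrDl mul1r addrC.
  exact: lerD.
have := tele n (leqnn n); rewrite subnn mul0r heat0 -tE => /le_trans; apply.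
rewrite (_ : _ * _ = (2 * K * t) * D); last by rewrite tE; ring.
by rewrite mulrCA ler_piMr ?(ltW e0)// ler_pdivrMr; lra.
Qed.

(** On finitely supported functions, which lie in l^2, both semigroups agree; both are
    contractions of l^p, where these functions are dense. *)
Lemma heat_unique p t f : (1 <= p)%E -> (p < +oo)%E -> 0 <= t -> lp m p f ->
  T t f = S t f.
Proof.
case: p => [r| |]// r1 _ t0 fp; apply: (eq_of_lnorm_small m_gt0 r1) => e e0.
have [phi phic fphi] := Cc_dense m_gt0 (r1 : 1 <= r) fp e0.
have phip := Cc_lp m_gt0 r1 phic.
have dphi : (lnorm m r%:E (fun x => (-1) * f x + phi x)%R <= e%:E)%E.
  move: fphi; rewrite (@eq_lnorm _ _ _ _ _ (fun x => (-1) * f x + phi x))// => x.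
  by rewrite !fctE /= -normcN opprB mulN1r addrC.
exists (T t phi).
  have := semigroup_bound r1 t0 dphi; rewrite (semigroup_lin (-1) r1 t0 fp phip).
  by apply: eq_lnorm_le => x; rewrite mulN1r addrC.
rewrite (heat_unique_l2 t0 (Cc_lp m_gt0 p2 phic)).
have := heat_bound m_gt0 m_deg r1 t0 (ltW e0) dphi.
rewrite (heat_lin m_gt0 m_deg (-1) r1 t0 fp phip).
by apply: eq_lnorm_le => x; rewrite mulN1r addrC.
Qed.

End Uniqueness.

End HeatSemigroup.

(** * The operators on l^p and their spectra *)

Section Spectrum.
Variables (R : realType) (X : countType) (G : graph R X) (m : X -> R).
Hypothesis m_gt0 : forall x, 0 < m x.
Hypothesis m_deg : forall x, m x = degree G x.
Hypothesis c_eq0 : forall x, gc G x = 0.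
Implicit Types (f g u : X -> R[i]) (C : R) (p : \bar R) (z : R[i]).

Local Notation mean := (averaging G m).
Local Notation L := (laplacian G m).
Local Notation Phi := (power_series G m).

(** The explicit semigroup is a witness, and uniqueness transfers the generator of any
    other heat semigroup to it. *)
Lemma Lp_fin_laplacian p f g : (1 <= p)%E -> (p < +oo)%E ->
  Lp_fin G m p f g <-> lp m p f /\ g = L f.
Proof.
move=> p1 poo; split; last first.
  move=> h; exists (heat G m); first exact: heat_is_heat_semigroup.
  exact/(heat_generator m_gt0 m_deg f g p1).
move=> [T Theat [fp gp cv]]; apply/(heat_generator m_gt0 m_deg f g p1); split => //.
apply/right_cvg0P => [t|e e0]; first exact: lnorm_ge0.
move/right_cvg0P: cv => /(_ (fun=> lnorm_ge0 _ _ _))/(_ e e0)[d d0 hd].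
exists d => // t t0 td.
by rewrite -(heat_unique m_gt0 m_deg c_eq0 Theat p1 poo (ltW t0) fp); exact: hd.
Qed.

Lemma l1_sup_edge_summable h u : lp m 1%:E h -> lp m +oo u ->
  edge_summable (diagonal_term G h u) /\ edge_summable (cross_term G h u).
Proof.
move=> h1 /lp_bound[C C0 uC].
have {}uC x : normc (u x) <= C by move: x; apply/(lnorm_yP m u C0); rewrite uC.
have [D D0 hD] := lp_bound h1.
pose v x := C * normc (h x).
have v0 x : 0 <= v x by rewrite mulr_ge0 ?normc_ge0.
have vfin : (nsum (fun x => (m x * v x)%R) < +oo)%E.
  have hh : (nsum (fun x => (normc (h x) `^ 1 * m x)%R) <= (D `^ 1)%:E)%E.
    by apply/lnorm_finP => //; rewrite hD.
  rewrite (@eq_nsum _ _ _ (fun x => C * (normc (h x) `^ 1 * m x))); last first.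
    by move=> x; rewrite powRr1 ?normc_ge0// /v; ring.
  rewrite nsumZl//; last by move=> x; rewrite mulr_ge0 ?powR_ge0// ltW.
  by apply: lte_mul_pinfty; rewrite ?lee_fin//; apply: le_lt_trans hh _; rewrite ltry.
have key E : (forall x y, E x y <= gb G x y * v x + gb G x y * v y) ->
    (\esum_(x in [set: X]) nsum (E x) < +oo)%E.
  move=> /(esum_edges_le m_deg v0 v0)/le_lt_trans; apply.
  exact: lte_add_pinfty.
have bv0 x y w : 0 <= gb G x y * v w by rewrite mulr_ge0// gb_ge0.
split; apply: key => x y; rewrite normc_edge.
  apply: (@le_trans _ _ (gb G x y * v x)); last by rewrite lerDl.
  by rewrite ler_wpM2l ?gb_ge0// mulrC ler_wpM2r ?normc_ge0.
apply: (@le_trans _ _ (gb G x y * v y)); last by rewrite lerDr.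
by rewrite ler_wpM2l ?gb_ge0// mulrC ler_wpM2r ?normc_ge0.
Qed.

(** L is symmetric in the pairing of l^1 and l^oo, and unit masses in l^1 separate
    points of l^oo. *)
Lemma adjoint_laplacian f g :
  adjoint1 m (Lp_fin G m 1%E) f g <-> lp m +oo f /\ g = L f.
Proof.
have p1 : (1 <= 1%:E :> \bar R)%E by rewrite lee_fin.
have py : (1 <= +oo :> \bar R)%E by rewrite leey.
have sym h : lp m 1%:E h -> lp m +oo f ->
    dual_pairing m (L h) f = dual_pairing m h (L f).
  move=> h1 fy; have [ds cs] := l1_sup_edge_summable h1 fy.
  exact: (laplacian_symmetric m_gt0 m_deg p1 py).
split; last first.
  move=> [fy ->]; split => //; first exact: laplacian_lp.
  by move=> h k /(Lp_fin_laplacian _ _ p1 (ltry 1))[h1 ->]; exact: sym.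
move=> [fy gy fg]; split => //; apply/funext => x.
pose d y : R[i] := (y == x)%:R.
have dp : lp m 1%:E d by apply: Cc_lp => //; exact: Cc_delta.
have e u : dual_pairing m d u = u x * (m x)%:C.
  rewrite /dual_pairing (@csum_delta _ _ _ x); first by rewrite /d eqxx mul1r.
  by move=> y /negbTE yx; rewrite /d yx !mul0r.
have mx : (m x)%:C != 0 :> R[i] by rewrite fmorph_eq0 gt_eqF.
have := fg d (L d) ((Lp_fin_laplacian d (L d) p1 (ltry 1)).2 (conj dp erefl)).
by rewrite (sym d dp fy) !e => /(mulIf mx).
Qed.

Lemma Lp_laplacian p f g : (1 <= p)%E -> Lp G m p f g <-> lp m p f /\ g = L f.
Proof.
case: p => [r| |]// p1; first by apply: Lp_fin_laplacian => //; exact: ltry.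
exact: adjoint_laplacian.
Qed.

Lemma resolventP p z : (1 <= p)%E ->
  in_resolvent_set m p (Lp G m p) z <->
  exists2 B : (X -> R[i]) -> (X -> R[i]),
    exists M : R, forall f, lp m p f -> (lnorm m p (B f) <= M%:E * lnorm m p f)%E &
    (forall g, lp m p g -> lp m p (B g) /\ (fun x => z * B g x - L (B g) x) = g) /\
    (forall f, lp m p f -> B (fun x => z * f x - L f x) = f).
Proof.
move=> p1; split=> -[B BM [Br Bl]]; exists B => //; split.
- by move=> g /Br[h /(Lp_laplacian _ _ p1)[Bp ->]].
- by move=> f fp; apply: (Bl f (L f)); apply/Lp_laplacian.
- by move=> g /Br[Bp e]; exists (L (B g)) => //; apply/Lp_laplacian.
- by move=> f h /(Lp_laplacian _ _ p1)[fp ->]; exact: Bl.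
Qed.

Lemma nsum_geometric (q : R) : 0 <= q -> q < 1 ->
  (nsum (fun n => (q ^+ n)%R) <= ((1 - q)^-1)%:E)%E.
Proof.
move=> q0 q1; rewrite /nsum -nneseries_esumT; last first.
  by move=> n; rewrite lee_fin exprn_ge0.
apply: lime_le; first by apply: is_cvg_nneseries => n _ _; rewrite lee_fin exprn_ge0.
apply: nearW => n; rewrite sumEFin lee_fin.
have q1' : 0 < 1 - q by rewrite subr_gt0.
rewrite -[leRHS]mul1r ler_pdivlMr// big_mkord.
have := subrX1 q n; rewrite -[_ - 1]opprB -[q - 1]opprB mulNr => /oppr_inj.
move=> e; rewrite mulrC -e lerBlDr lerDl exprn_ge0//.
Qed.

(** Coefficients of 1 / (w + P) in powers of P, for z - L = w + P with w = z - 1. *)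
Definition neumann_coef (w : R[i]) (n : nat) : R[i] := (-1) ^+ n * w^-1 ^+ n.+1.

Lemma normc_exp (a : R[i]) n : normc (a ^+ n) = normc a ^+ n.
Proof. by elim: n => [|n ih]; rewrite ?expr0 ?normc1// !exprS normcM ih. Qed.

Lemma neumann_coef_sum w : 1 < normc w ->
  (nsum (fun n => normc (neumann_coef w n)) <= ((1 - (normc w)^-1)^-1)%:E)%E.
Proof.
move=> w1; have w0 : 0 < normc w by lra.
have q1 : (normc w)^-1 < 1 by rewrite invf_lt1.
have q0 : 0 <= (normc w)^-1 by rewrite invr_ge0 ltW.
apply: le_trans (nsum_geometric q0 q1); apply: le_nsum => n.
rewrite /neumann_coef normcM !normc_exp normcN normc1 expr1n mul1r normcV.
by rewrite exprS ler_piMl ?exprn_ge0// ltW.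
Qed.

(** The series telescopes, as w a_(n+1) = - a_n. *)
Lemma neumann_inverse p w f : (1 <= p)%E -> 1 < normc w -> lp m p f ->
  (fun x => w * Phi (neumann_coef w) f x + Phi (neumann_coef w) (mean f) x) = f.
Proof.
move=> p1 w1 fp; have w0 : w != 0.
  by apply/eqP => w0; move: w1; rewrite w0 normc0 ltr10.
have as_ : csummable (neumann_coef w).
  by apply: le_lt_trans (neumann_coef_sum w1) _; rewrite ltry.
apply/funext => x.
have s := power_series_summable m_gt0 m_deg x p1 as_ fp.
have s' := power_series_summable m_gt0 m_deg x p1 as_ (mean_lp m_gt0 m_deg p1 fp).
rewrite /power_series -csumZ// csum_recl; last exact: csummableZ.
rewrite -addrA [X in _ + (X + _)](_ : _ = - csum (fun n => neumann_coef w n * iter n mean (mean f) x)).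
  by rewrite addNr addr0 /neumann_coef expr0 mul1r expr1 mulVKf.
rewrite -csumN; apply: eq_csum => n; rewrite /= -iterSr iterS /neumann_coef.
rewrite exprS [w^-1 ^+ n.+2]exprS.
move: (w^-1 ^+ n.+1) ((-1) ^+ n : R[i]) (mean _ x) => a b c.
by field.
Qed.

Lemma resolvent_outside_disk p z : (1 <= p)%E -> 1 < normc (z - 1) ->
  in_resolvent_set m p (Lp G m p) z.
Proof.
move=> p1; set w := z - 1 => w1.
have as_ : csummable (neumann_coef w).
  by apply: le_lt_trans (neumann_coef_sum w1) _; rewrite ltry.
have A0 : 0 < (1 - (normc w)^-1)^-1.
  by rewrite invr_gt0 subr_gt0 invf_lt1//; lra.
have zE f x : z * f x - L f x = w * f x + mean f x.
  by rewrite /laplacian /w; ring.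
apply/(resolventP _ p1); exists (Phi (neumann_coef w)).
  exists (1 - (normc w)^-1)^-1 => f fp; have [C C0 fC] := lp_bound fp.
  have fC' : (lnorm m p f <= C%:E)%E by rewrite fC.
  have [_] := power_series_bound m_gt0 m_deg p1 A0 C0 (neumann_coef_sum w1) fC'.
  by rewrite fC -EFinM.
split=> [g gp|f fp].
  have Pp := power_series_lp m_gt0 m_deg p1 as_ gp; split => //.
  rewrite -[RHS](neumann_inverse p1 w1 gp); apply/funext => x.
  by rewrite zE (mean_power_series m_gt0 m_deg p1 as_ gp).
rewrite -[RHS](neumann_inverse p1 w1 fp).
have mfp := mean_lp m_gt0 m_deg p1 fp.
rewrite -(power_series_lin m_gt0 m_deg w p1 as_ fp mfp).
by congr (power_series _ _ _ _); apply/funext => x; exact: zE.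
Qed.

Lemma conjcB (a b : R[i]) : conjc (a - b) = conjc a - conjc b.
Proof. exact: rmorphB. Qed.

Lemma conjcM (a b : R[i]) : conjc (a * b) = conjc a * conjc b.
Proof. exact: rmorphM. Qed.

Lemma laplacian_conj f : L (fun x => conjc (f x)) = (fun x => conjc (L f x)).
Proof.
apply/funext => x; rewrite /laplacian conjcB; congr (_ - _).
rewrite /averaging -csumJ; apply: eq_csum => y.
by rewrite conjcM conjc_real.
Qed.

Lemma lnorm_conj p f : lnorm m p (fun x => conjc (f x)) = lnorm m p f.
Proof. by apply: eq_lnorm => x; exact: normc_conj. Qed.

Lemma lp_conj p f : lp m p f -> lp m p (fun x => conjc (f x)).
Proof. by move=> fp; apply: le_lt_trans fp; rewrite lnorm_conj. Qed.

(** Conjugating by the antilinear isometry J, which commutes with L, sends z - L to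
    conj z - L. *)
Lemma resolvent_conj p z : (1 <= p)%E ->
  in_resolvent_set m p (Lp G m p) z -> in_resolvent_set m p (Lp G m p) (conjc z).
Proof.
move=> p1 /(resolventP _ p1)[B [M BM] [Br Bl]]; apply/(resolventP _ p1).
pose J f : X -> R[i] := fun x => conjc (f x).
have JK f : J (J f) = f by apply/funext => x; exact: conjcK.
have JL u : (fun x => conjc z * J u x - L (J u) x) = J (fun x => z * u x - L u x).
  by apply/funext => x; rewrite laplacian_conj /J [RHS]conjcB conjcM.
exists (fun f => J (B (J f))).
  exists M => f fp; rewrite lnorm_conj -(lnorm_conj p f); apply: BM.
  exact: lp_conj.
split=> [g gp|f fp].
  have [Bp e] := Br _ (lp_conj gp).
  by split; [exact: lp_conj|rewrite JL [X in J X]e JK].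
rewrite -{1 2}(JK f) JL JK Bl ?JK//; exact: lp_conj.
Qed.

(** Multiplication U by the sign of the part satisfies U P U = - P, hence
    (2 - z) - L = - U (z - L) U and its inverse is - U B U. *)
Lemma resolvent_reflect p z : (1 <= p)%E -> bipartite G ->
  in_resolvent_set m p (Lp G m p) z -> in_resolvent_set m p (Lp G m p) (2 - z).
Proof.
move=> p1 [X1 [X2 [_ X12 edge]]] /(resolventP _ p1)[B [M BM] [Br Bl]].
apply/(resolventP _ p1).
pose s x : R[i] := if x \in X1 then 1 else -1.
have ss x : s x * s x = 1 by rewrite /s; case: ifP; rewrite ?mulr1// mulrNN mulr1.
have sn x : normc (s x) = 1 by rewrite /s; case: ifP; rewrite ?normcN normc1.
have notX1 x : X2 x -> (x \in X1) = false.
  move=> x2; apply/negP => /set_mem x1.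
  by have : (X1 `&` X2) x by []; rewrite X12.
have sb x y : 0 < gb G x y -> s y = - s x.
  move=> /edge[[x1 y2]|[x2 y1]]; rewrite /s.
    by rewrite (mem_set x1) (notX1 _ y2).
  by rewrite (mem_set y1) (notX1 _ x2) opprK.
pose U f : X -> R[i] := fun x => s x * f x.
have Un f x : normc (U f x) = normc (f x) by rewrite /U normcM sn mul1r.
have Ulp f : lp m p f -> lp m p (U f).
  by move=> fp; apply: le_lt_trans fp; rewrite (@eq_lnorm _ _ m p (U f) f).
pose N f : X -> R[i] := fun x => - f x.
have Nn f x : normc (N f x) = normc (f x) by rewrite /N normcN.
have Nlp f : lp m p f -> lp m p (N f).
  by move=> fp; apply: le_lt_trans fp; rewrite (@eq_lnorm _ _ m p (N f) f).
have Umean f x : lp m p f -> mean (U f) x = - (s x * mean f x).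
  move=> /lp_bound[C C0 fC]; have fC' : (lnorm m p f <= C%:E)%E by rewrite fC.
  have [sf _] := mean_bound m_gt0 m_deg p1 C0 fC'.
  rewrite -mulNr -csumZ//; apply: eq_csum => y; rewrite /U.
  have := gb_ge0 G x y; rewrite le_eqVlt => /predU1P[<-|/sb ->].
    by rewrite mul0r !mul0r mulr0.
  by ring.
have Nmean f x : mean (N f) x = - mean f x.
  by rewrite -csumN; apply: eq_csum => y; rewrite /N mulrN.
exists (fun f => N (U (B (U f)))).
  exists M => f fp; rewrite (eq_lnorm m p (Nn (U (B (U f))))) (eq_lnorm m p (Un (B (U f)))).
  by rewrite -(eq_lnorm m p (Un f)); apply: BM; exact: Ulp.
split=> [g gp|f fp].
  have [Bp e] := Br _ (Ulp _ gp); split; first exact/Nlp/Ulp.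
  apply/funext => x.
  have ex : z * B (U g) x - L (B (U g)) x = U g x := congr1 (fun k => k x) e.
  have gx : g x = s x * U g x by rewrite /U mulrA ss mul1r.
  by rewrite gx -ex /laplacian Nmean Umean// /N /U; ring.
have Up := Ulp _ fp; have NUp := Nlp _ Up.
(* B is only known on functions of the form z u - L u: the sign goes inside u. *)
have -> : U (fun x => (2 - z) * f x - L f x) = (fun x => z * N (U f) x - L (N (U f)) x).
  by apply/funext => x; rewrite /laplacian Nmean Umean// /N /U; ring.
rewrite (Bl _ NUp); apply/funext => x.
by rewrite /N /U mulrN opprK mulrA ss mul1r.
Qed.

End Spectrum.

Theorem theorem6p1 (R : realType) (X : countType) (G : graph R X) (m : X -> R)
    (m_gt0 : forall x, 0 < m x)
    (m_deg : forall x, m x = degree G x)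
    (c_eq0 : forall x, gc G x = 0)
    (p : \bar R) (p_ge1 : (1 <= p)%E) :
  [/\ spectrum m p (Lp G m p) `<=` [set z : R[i] | `|z - 1| <= 1],
      forall z : R[i],
        spectrum m p (Lp G m p) z <-> spectrum m p (Lp G m p) z^* &
      bipartite G -> forall z : R[i],
        spectrum m p (Lp G m p) z <-> spectrum m p (Lp G m p) (2 - z)].
Proof.
split.
- move=> z /= zs; rewrite normr_normc lecR leNgt; apply/negP => z1.
  by apply: zs; exact: resolvent_outside_disk.
- move=> z; split=> zs zr; apply: zs.
    by rewrite -(conjcK z); exact: resolvent_conj.
  exact: resolvent_conj.
move=> bip z; split=> zs zr; apply: zs.
  rewrite (_ : z = 2 - (2 - z)); last by ring.
  exact: resolvent_reflect.
exact: resolvent_reflect.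
Qed.
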